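(* Fix $n\ge 0$. Let $\gamma_{i,j}(q)$, $0\le i,j\le n$, denote the matrix entries of the operator $\mathcal A_n^+(q)\oplus\mathcal A_n^-(q)$ on $\mathbb C^{n+1}=H_n^+\oplus H_n^-$. Then: (i) every coefficient of the $q$-expansion of each $\gamma_{i,j}(q)$ belongs to the ring $\mathbb Z^{\mathrm{cyc}}[\tfrac12]$; (ii) for every $m\ge 1$, every coefficient of the $q$-expansion of $\mathrm{Tr}(\wedge^m\mathcal A_n^\pm(q))$ belongs to $\mathbb Z[1/\sqrt2]$; (iii) every coefficient of the $q$-expansion of $D_n(q)/D_n(0)$ belongs to $\mathbb Z[1/\sqrt2]$.
   Context: For integers $k\ge0$ put $\alpha_k:=(-4)^{-k}\binom{2k}{k}$. Put $c_0(2k):=(-1)^k\frac{d^{2k}}{dx^{2k}}\big(e^{x}+e^{-x}\big)^{-1/2}\big|_{x=0}$ and $c_0(2k+1):=0$. For $|q|<1$ (or as formal power series in $q$) define $c(2k)(q):=c_0(2k)+2(-1)^k\sum_{\ell\ge0}\alpha_\ell(\tfrac12+2\ell)^{2k}\frac{q^{2\ell+1}}{1-q^{2\ell+1}}$ and $c(2k+1)(q):=0$. For $n\ge0$ let $\mathcal D_n(q)=(c(i+j)(q))_{0\le i,j\le n}$ be the Hankel matrix and $D_n(q):=\det\mathcal D_n(q)$ (so $D_n(0)\neq 0$ is the determinant of $(c_0(i+j))$). For $m\ge0$ let $\mathcal P_m(x):=\sqrt{(2m)!}\sum_{k=0}^m(-1)^k2^{3k-m}\frac{\prod_{j=0}^{k-1}(j-\frac{ix}{2}+\frac14)}{(2k)!\,(m-k)!}$.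 Index the coordinates of $\mathbb C^{n+1}$ by $0,\dots,n$ (standard inner product); let $H_n^+$ (resp. $H_n^-$) be the subspace of vectors whose odd-indexed (resp. even-indexed) coordinates vanish. For $\ell\ge0$ let $\eta_\ell\in\mathbb R^{n+1}$ have coordinates $\eta_\ell(m):=\mathcal P_m(-i(\tfrac12+2\ell))$ (these are real) and $\eta_\ell^\pm(m):=\frac{1\pm(-1)^m}{2}\eta_\ell(m)$. Define $\mathcal A_n^\pm(q):=\pm 2^{3/2}\sum_{\ell\ge0}\alpha_\ell\frac{q^{2\ell+1}}{1-q^{2\ell+1}}\,|\eta_\ell^\pm\rangle\langle\eta_\ell^\pm|$, viewed as an operator on $H_n^\pm$ with entries power series in $q$, where $|\xi\rangle\langle\eta|$ denotes $v\mapsto\langle\eta,v\rangle\xi$. $\mathbb Z^{\mathrm{cyc}}$ denotes the ring of cyclotomic integers (integers of the field generated by all roots of unity). *)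

(* Defs.v *)
From HB Require Import structures.
From mathcomp Require Import all_boot all_order all_algebra.
From mathcomp Require Import all_classical all_reals all_analysis.
From mathcomp Require Import complex.

Set Implicit Arguments.
Unset Strict Implicit.
Unset Printing Implicit Defensive.

Import Order.TTheory GRing.Theory Num.Theory.
Import numFieldNormedType.Exports.

Local Open Scope complex_scope.
Local Open Scope ring_scope.

(** * Formal power series in [q] *)

(* A record, not a bare [nat -> K], so that the Cauchy product is not shadowed
   by the pointwise ring structure on functions. *)
Record fps (K : Type) := Fps { fcoef : nat -> K }.

Lemma fpsP (K : Type) (f g : fps K) : fcoef f =1 fcoef g <-> f = g.
Proof. by case: f g => [f] [g] /=; split=> [/funext ->|[->]]. Qed.

HB.instance Definition _ (K : Type) := gen_eqMixin (fps K).
HB.instance Definition _ (K : Type) := gen_choiceMixin (fps K).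

Section FpsRing.
Variable K : fieldType.
Implicit Types f g h : fps K.

Definition fpsC (c : K) : fps K := Fps (fun n => if n is 0%N then c else 0).
Definition fpsX : fps K := Fps (fun n => (n == 1%N)%:R).
Definition fps_opp f : fps K := Fps (fun n => - fcoef f n).
Definition fps_add f g : fps K := Fps (fun n => fcoef f n + fcoef g n).
Definition fps_mul f g : fps K :=
  Fps (fun n => \sum_(i < n.+1) fcoef f i * fcoef g (n - i)%N).

Fact fps_addA : associative fps_add.
Proof. by move=> f g h; apply/fpsP=> n /=; rewrite addrA. Qed.
Fact fps_addC : commutative fps_add.
Proof. by move=> f g; apply/fpsP=> n /=; rewrite addrC. Qed.
Fact fps_add0 : left_id (fpsC 0) fps_add.
Proof. by move=> f; apply/fpsP=> -[|n] /=; rewrite add0r. Qed.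
Fact fps_addN : left_inverse (fpsC 0) fps_opp fps_add.
Proof. by move=> f; apply/fpsP=> -[|n] /=; rewrite addNr. Qed.

HB.instance Definition _ :=
  GRing.isZmodule.Build (fps K) fps_addA fps_addC fps_add0 fps_addN.

Definition fps_trunc N f : {poly K} := \poly_(i < N) fcoef f i.

Lemma coef_fps_trunc N f i : (i < N)%N -> (fps_trunc N f)`_i = fcoef f i.
Proof. by move=> ltiN; rewrite coef_poly ltiN. Qed.

Lemma coef_fps_truncM N f g i : (i < N)%N ->
  (fps_trunc N f * fps_trunc N g)`_i = fcoef (fps_mul f g) i.
Proof.
move=> ltiN; rewrite coefM /=; apply: eq_bigr => j _.
rewrite !coef_fps_trunc//; last by apply: leq_trans ltiN; rewrite ltnS -ltnS.
exact: leq_ltn_trans (leq_subr _ _) ltiN.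
Qed.

Fact fps_mulC : commutative fps_mul.
Proof.
by move=> f g; apply/fpsP=> n; rewrite -!(@coef_fps_truncM n.+1)// mulrC.
Qed.
Fact fps_mulA : associative fps_mul.
Proof.
move=> f g h; apply/fpsP=> n.
have tl (a b c : fps K) : fcoef (fps_mul a (fps_mul b c)) n =
    (fps_trunc n.+1 a * (fps_trunc n.+1 b * fps_trunc n.+1 c))`_n.
  rewrite coefM /=; apply: eq_bigr => j _.
  by rewrite coef_fps_truncM ?coef_fps_trunc// ltnS leq_subr.
rewrite (fps_mulC (fps_mul f g)) !tl; congr (_`_n).
by rewrite mulrA mulrC.
Qed.
Fact fps_mul1 : left_id (fpsC 1) fps_mul.
Proof.
move=> f; apply/fpsP=> n /=; rewrite big_ord_recl/= subn0 mul1r.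
by rewrite big1 ?addr0// => i _; rewrite mul0r.
Qed.
Fact fps_mulDl : left_distributive fps_mul +%R.
Proof.
move=> f g h; apply/fpsP=> n /=; rewrite -big_split/=.
by apply: eq_bigr => i _; rewrite mulrDl.
Qed.
Fact fps_1neq0 : fpsC 1 != 0.
Proof.
by apply/eqP=> /fpsP/(_ 0%N) /= /eqP; rewrite oner_eq0.
Qed.

HB.instance Definition _ := GRing.Zmodule_isComNzRing.Build (fps K)
  fps_mulA fps_mulC fps_mul1 fps_mulDl fps_1neq0.

Lemma fcoefM f g n :
  fcoef (f * g) n = \sum_(i < n.+1) fcoef f i * fcoef g (n - i)%N.
Proof. by []. Qed.

Lemma fcoefD f g n : fcoef (f + g) n = fcoef f n + fcoef g n.
Proof. by []. Qed.

Lemma fcoef_sum (I : Type) (r : seq I) (P : pred I) (F : I -> fps K) n :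
  fcoef (\sum_(i <- r | P i) F i) n = \sum_(i <- r | P i) fcoef (F i) n.
Proof. by elim/big_rec2: _ => [|i x y _ <-//]; case: n. Qed.

Lemma fcoefCM c f n : fcoef (fpsC c * f) n = c * fcoef f n.
Proof.
rewrite fcoefM big_ord_recl/= subn0 big1 ?addr0// => i _.
by rewrite mul0r.
Qed.

Lemma fcoefX_lt u j i : fcoef u 0 = 0 -> (i < j)%N -> fcoef (u ^+ j) i = 0.
Proof.
move=> u0; elim: j i => // j IHj i ltij.
rewrite exprS fcoefM big_ord_recl u0 mul0r add0r big1// => k _.
by rewrite IHj ?mulr0// lift0; case: i k ltij => [[]|i k ltij]//;
  rewrite subSS; apply: leq_ltn_trans (leq_subr _ _) _.
Qed.

Definition fps_unit : pred (fps K) := fun f => fcoef f 0 != 0.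

(* [f^-1 = c (1 + u + u^2 + ...)] with [c = f(0)^-1] and [u = 1 - c f]; the
   powers [u^j] with [j > n] do not contribute to the coefficient of [q^n]. *)
Definition fps_inv f : fps K :=
  if fps_unit f then
    let c := (fcoef f 0)^-1 in
    Fps (fun n => \sum_(j < n.+1) c * fcoef ((1 - fpsC c * f) ^+ j) n)
  else f.

Fact fps_mulVf : {in fps_unit, left_inverse 1 fps_inv *%R}.
Proof.
move=> f fU; have f0 : fcoef f 0 != 0 by [].
apply/fpsP => n; rewrite /fps_inv (_ : fps_unit f = true)//.
set c := (fcoef f 0)^-1; set u := 1 - fpsC c * f.
have u0 : fcoef u 0 = 0 by rewrite /u /= big_ord1/= mulVf// subrr.
have -> : fcoef (Fps (fun m => \sum_(j < m.+1) c * fcoef (u ^+ j) m) * f) n =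
          fcoef ((fpsC c * \sum_(j < n.+1) u ^+ j) * f) n.
  rewrite !fcoefM; apply: eq_bigr => i _; congr (_ * _).
  rewrite fcoefCM fcoef_sum mulr_sumr [LHS]/fcoef.
  have le_in : (i.+1 <= n.+1)%N by [].
  rewrite (big_ord_widen _ (fun j => c * fcoef (u ^+ j) i) le_in) big_mkcond/=.
  apply: eq_bigr => j _; case: ifPn => //; rewrite -leqNgt => ltij.
  by rewrite fcoefX_lt// mulr0.
have cf : fpsC c * f = 1 - u by rewrite opprB addrC subrK.
rewrite -mulrA [_ * f]mulrC mulrA cf -opprB mulNr -subrX1 opprB.
by rewrite /= fcoefX_lt// subr0.
Qed.

Fact fps_unitPl f g : g * f = 1 -> fps_unit f.
Proof.
move=> /fpsP/(_ 0%N); rewrite fcoefM big_ord1/= => gf.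
by apply/eqP => f0; move/eqP: gf; rewrite f0 mulr0 eq_sym oner_eq0.
Qed.

Fact fps_inv_out : {in [predC fps_unit], fps_inv =1 id}.
Proof. move=> f fN; rewrite /fps_inv (_ : fps_unit f = false)//.
exact: negPf fN. Qed.

HB.instance Definition _ := GRing.ComNzRing_hasMulInverse.Build (fps K)
  fps_mulVf fps_unitPl fps_inv_out.

(* Sum of a locally finite family of series: each coefficient is the sum of
   the finitely many nonzero coefficients of the members of the family. *)
Definition fps_lfsum (F : nat -> fps K) : fps K :=
  Fps (fun n => \sum_(l \in [set: nat]%classic) fcoef (F l) n).

(* [q^r / (1 - q^r)] *)
Definition lambert (r : nat) : fps K := fpsX ^+ r / (1 - fpsX ^+ r).

Lemma lambert_unit r : (0 < r)%N -> 1 - fpsX ^+ r \is a GRing.unit.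
Proof.
move=> r0; suff f0 : fcoef (1 - fpsX ^+ r) 0 != 0 by exact: f0.
by rewrite fcoefD /= fcoefX_lt// subr0 oner_eq0.
Qed.

Lemma fcoef_lambert_lt r i : (i < r)%N -> fcoef (lambert r) i = 0.
Proof.
move=> ltir; rewrite fcoefM big1// => j _.
have ltjr : (j < r)%N by exact: leq_trans (ltn_ord j) ltir.
by rewrite fcoefX_lt// mul0r.
Qed.

End FpsRing.

(** * Exterior powers *)

Section Exterior.
Variables (K : comNzRingType) (d : nat).

(* The exterior algebra of [K^d]: [u S] is the coordinate of [u] on
   [e_S = e_(s_1) /\ ... /\ e_(s_m)], for [S = {s_1 < ... < s_m}]. *)
Definition extalg := {ffun {set 'I_d} -> K}.

Definition inversions (S T : {set 'I_d}) : nat :=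
  #|[pred p : 'I_d * 'I_d | [&& p.1 \in S, p.2 \in T & (p.2 < p.1)%N]]|.

(* Bilinear, with [e_S /\ e_T = (-1)^(inversions S T) e_(S :|: T)] for disjoint
   [S] and [T], and [e_S /\ e_T = 0] otherwise. *)
Definition wedge (u v : extalg) : extalg :=
  [ffun U : {set 'I_d} => \sum_(S : {set 'I_d} | S \subset U)
     (-1) ^+ inversions S (U :\: S) * u S * v (U :\: S)].

Definition ext_one : extalg := [ffun U : {set 'I_d} => (#|U| == 0)%:R].

Definition ext_vec (v : 'cV[K]_d) : extalg :=
  [ffun U : {set 'I_d} => \sum_(i | U == finset.set1 i) v i 0].

Definition wedge_seq (vs : seq 'cV[K]_d) : extalg :=
  foldr wedge ext_one [seq ext_vec v | v <- vs].

(* The matrix, in the basis [(e_S)] with [#|S| = m], of the endomorphism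
   [v_1 /\ ... /\ v_m |-> A v_1 /\ ... /\ A v_m] of the [m]-th exterior power;
   [col i A] is [A e_i], and [enum S] lists [S] in increasing order. *)
Definition extpow (m : nat) (A : 'M[K]_d) :
    'M[K]_#|[pred S : {set 'I_d} | #|S| == m]| :=
  \matrix_(a, b)
    wedge_seq [seq col i A | i <- enum (enum_val b : {set 'I_d})] (enum_val a).

End Exterior.

(** * Coefficient rings *)

Section CoefficientRings.
Variable R : realType.

Definition subring_gen (G : set R[i]) : set R[i] :=
  smallest (fun S : set R[i] => subring_closed (mem S)) G.

Definition subfield_gen (G : set R[i]) : set R[i] :=
  smallest (fun S : set R[i] => divring_closed (mem S)) G.

Definition roots_of_unity : set R[i] :=
  [set w | exists2 m, (0 < m)%N & m.-unity_root w]%classic.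

Definition cyclotomic_integers : set R[i] :=
  [set z | subfield_gen roots_of_unity z /\
           integralOver (intr : int -> R[i]) z]%classic.

Definition Zcyc_half : set R[i] :=
  subring_gen (cyclotomic_integers `|` [set 2^-1])%classic.

Definition Z_invsqrt2 : set R[i] :=
  subring_gen [set ((Num.sqrt 2)^-1)%:C]%classic.

End CoefficientRings.

(** * The Hankel determinants and the operators *)

Section Main.
Variable R : realType.

Definition alpha (k : nat) : R := (- 4) ^- k * 'C(2 * k, k)%:R.

Definition c0 (j : nat) : R :=
  if odd j then 0
  else (-1) ^+ j./2 *
       derive1n j (fun x : R => (expR x + expR (- x)) `^ (- (1 / 2))) 0.

Definition cq (j : nat) : fps R[i] :=
  if odd j then 0
  else fpsC (c0 j)%:C + 2 * (-1) ^+ j./2 *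
       fps_lfsum (fun l => fpsC (alpha l * (1 / 2 + 2 * l%:R) ^+ j)%:C *
                           lambert _ (2 * l + 1)).

Definition Hankel (n : nat) : 'M[fps R[i]]_n.+1 := \matrix_(i, j) cq (i + j).

Definition Dq (n : nat) : fps R[i] := \det (Hankel n).

Definition calP (m : nat) (x : R[i]) : R[i] :=
  (Num.sqrt ((2 * m)`!%:R : R))%:C *
  \sum_(k < m.+1) (-1) ^+ k * 2 ^ ((3 * k)%:Z - m%:Z) *
     (\prod_(j < k) (j%:R - 'i%C * x / 2 + 1 / 4)) /
     ((2 * k)`!%:R * (m - k)`!%:R).

(* In what follows [s = false] stands for the sign [+] and [s = true] for the
   sign [-], so that the sign is [(-1) ^+ s]. *)

Definition eta (n l : nat) : 'cV[R[i]]_n.+1 :=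
  \col_m calP m (- 'i%C * (1 / 2 + 2 * l%:R)).

Definition eta_pm (n : nat) (s : bool) (l : nat) : 'cV[R[i]]_n.+1 :=
  \col_m ((1 + (-1) ^+ s * (-1) ^+ m) / 2 * eta n l m 0).

(* [|xi><zeta| : v |-> <zeta, v> xi], the inner product being antilinear in its
   first argument *)
Definition ketbra (d : nat) (xi zeta : 'cV[R[i]]_d) : 'M[R[i]]_d :=
  \matrix_(i, j) (xi i 0 * (zeta j 0)^*).

Definition opA_formula (n : nat) (s : bool) : 'M[fps R[i]]_n.+1 :=
  \matrix_(i, j) ((-1) ^+ s * fpsC (2 `^ (3 / 2))%:C *
    fps_lfsum (fun l => fpsC (alpha l)%:C * lambert _ (2 * l + 1) *
                        fpsC (ketbra (eta_pm n s l) (eta_pm n s l) i j))).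

(* [H_n^s] has the basis [(e_i)] with [odd i = s]; [H_incl] is the matrix of
   its inclusion in the whole space, and [H_incl^T] that of the orthogonal
   projection onto it. *)
Definition H_dim (n : nat) (s : bool) : nat :=
  #|[pred i : 'I_n.+1 | odd i == s]|.

Definition H_incl (n : nat) (s : bool) : 'M[fps R[i]]_(n.+1, H_dim n s) :=
  \matrix_(i, k) (i == enum_val k)%:R.

Definition opA (n : nat) (s : bool) : 'M[fps R[i]]_(H_dim n s) :=
  (H_incl n s)^T *m opA_formula n s *m H_incl n s.

Definition gamma_mx (n : nat) : 'M[fps R[i]]_n.+1 :=
  \sum_(s : bool) H_incl n s *m opA n s *m (H_incl n s)^T.

End Main.

(* Main.v *)
From HB Require Import structures.
Require Import Defs.
From mathcomp Require Import all_boot all_order all_algebra.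
From mathcomp Require Import cyclic separable cyclotomic.
From mathcomp Require Import all_classical all_reals all_analysis.
From mathcomp Require Import complex.
From mathcomp Require Import ring zify.

Set Implicit Arguments.
Unset Strict Implicit.
Unset Printing Implicit Defensive.

Import Order.TTheory GRing.Theory Num.Theory.

Local Open Scope ring_scope.

(* Put [u_k = 'C(2k, k) / 4^k], [y_l = 1/2 + 2l] and
   [Q_m = \sum_k 'C(m, k) 2^k k! / h_k * binom(X/2 - 1/4, k)], where
   [h_k = k! u_k = (1/2)(3/2)...(k - 1/2)].  Then [alpha l = (-1)^l u_l] and the
   coordinates of [eta] are [sqrt u_m * Q_m(y_l)].  The numbers
   [u_m 'C(m, k) / u_k] are dyadic, and therefore so are both [u_m Q_m(y_l)] and
   [u_l Q_m(y_l)], and likewise at [- y_l].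

   (i) Each matrix element is a sum of terms [sqrt z] with [z] dyadic and
   nonnegative, and square roots of natural numbers are cyclotomic integers.

   (ii) Conjugation by [diag (sqrt u_i)], which preserves the traces of exterior
   powers, brings the entries of [opA] into [Z[1/sqrt 2]].

   (iii) With [F = (e^x + e^-x)^(-1/2)] and [D] the derivation, the functional
   [p |-> (p(D) F)(0)] maps [Q_m(X) Q_n(-X)] to [2^(-1/2) m! / h_m] if [m = n]
   and to [0] otherwise.  So multiplying the Hankel matrix by the (constant)
   coefficient matrices of the [sqrt 2 * u_m * Q_m(X)] and [Q_n(-X)] makes it
   the identity at [q = 0], with all coefficients in [Z[1/sqrt 2]]; its
   determinant is then [D_n(q) / D_n(0)]. *)

(** * Subrings and coefficients of power series *)

Section SubringGen.
Variable R : realType.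
Implicit Types (G : set R[i]) (z : R[i]).

(** Boolean forms of the generated sets, which can carry closure structures and so give access to
    the [rpred] lemmas. *)
Definition subring_pred G : R[i] -> bool := fun z => `[< subring_gen G z >].
Definition subfield_pred G : R[i] -> bool := fun z => `[< subfield_gen G z >].

Lemma subring_predP G z : reflect (subring_gen G z) (z \in subring_pred G).
Proof. exact: asboolP. Qed.

Lemma subfield_predP G z : reflect (subfield_gen G z) (z \in subfield_pred G).
Proof. exact: asboolP. Qed.

Lemma subring_gen_sub G z : G z -> z \in subring_pred G.
Proof. by move=> Gz; apply/subring_predP => A [_]; exact. Qed.

Lemma subfield_gen_sub G z : G z -> z \in subfield_pred G.
Proof. by move=> Gz; apply/subfield_predP => A [_]; exact. Qed.

Fact subring_gen_closed G : subring_closed (subring_pred G).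
Proof.
split.
- by apply/subring_predP => A [[A1 _ _] _]; exact: set_mem A1.
- move=> x y /subring_predP Gx /subring_predP Gy; apply/subring_predP => A clA.
  by have [[_ AB _] _] := clA; apply/set_mem/AB; apply/mem_set;
    [exact: Gx | exact: Gy].
- move=> x y /subring_predP Gx /subring_predP Gy; apply/subring_predP => A clA.
  by have [[_ _ AM] _] := clA; apply/set_mem/AM; apply/mem_set;
    [exact: Gx | exact: Gy].
Qed.

Fact subfield_gen_closed G : divring_closed (subfield_pred G).
Proof.
split.
- by apply/subfield_predP => A [[A1 _ _] _]; exact: set_mem A1.
- move=> x y /subfield_predP Gx /subfield_predP Gy; apply/subfield_predP.
  move=> A clA; have [[_ AB _] _] := clA.
  by apply/set_mem/AB; apply/mem_set; [exact: Gx | exact: Gy].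
- move=> x y /subfield_predP Gx /subfield_predP Gy; apply/subfield_predP.
  move=> A clA; have [[_ _ AV] _] := clA.
  by apply/set_mem/AV; apply/mem_set; [exact: Gx | exact: Gy].
Qed.

HB.instance Definition _ G :=
  GRing.isSubringClosed.Build R[i] (subring_pred G) (subring_gen_closed G).
HB.instance Definition _ G :=
  GRing.isDivringClosed.Build R[i] (subfield_pred G) (subfield_gen_closed G).

End SubringGen.

Section FpsOver.
Variable K : fieldType.

Definition fps_over (S : {pred K}) : fps K -> bool :=
  fun f => `[< forall k, fcoef f k \in S >].

Lemma fps_overP (S : {pred K}) f :
  reflect (forall k, fcoef f k \in S) (f \in fps_over S).
Proof. exact: asboolP. Qed.

Fact fps_over_closed (S : subringClosed K) : subring_closed (fps_over S).
Proof.
split.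
- by apply/fps_overP => -[|k] /=; rewrite ?rpred0 ?rpred1.
- move=> f g /fps_overP Sf /fps_overP Sg; apply/fps_overP => k.
  by rewrite rpredB.
- move=> f g /fps_overP Sf /fps_overP Sg; apply/fps_overP => k.
  by rewrite fcoefM rpred_sum// => i _; rewrite rpredM.
Qed.

HB.instance Definition _ (S : subringClosed K) :=
  GRing.isSubringClosed.Build (fps K) (fps_over S) (fps_over_closed S).

Lemma rpred_det (A : comNzRingType) (S : subringClosed A) n (M : 'M[A]_n) :
  (forall i j, M i j \in S) -> \det M \in S.
Proof.
move=> SM; rewrite rpred_sum// => s _.
by rewrite rpredM ?rpredX ?rpredN1 ?rpred_prod.
Qed.

Fact fpsC_additive : zmod_morphism (@fpsC K).
Proof. by move=> a b; apply/fpsP => -[|k] //=; rewrite subr0. Qed.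

Fact fpsC_multiplicative : monoid_morphism (@fpsC K).
Proof.
split=> // a b; apply/fpsP => -[|k]; rewrite fcoefCM //=.
by rewrite mulr0.
Qed.

HB.instance Definition _ :=
  GRing.isZmodMorphism.Build K (fps K) (@fpsC K) fpsC_additive.
HB.instance Definition _ :=
  GRing.isMonoidMorphism.Build K (fps K) (@fpsC K) fpsC_multiplicative.

Definition fps_coef0 (f : fps K) : K := fcoef f 0.

Fact fps_coef0_additive : zmod_morphism fps_coef0.
Proof. by []. Qed.

Fact fps_coef0_multiplicative : monoid_morphism fps_coef0.
Proof. by split=> // f g; rewrite /fps_coef0 fcoefM big_ord1. Qed.

HB.instance Definition _ :=
  GRing.isZmodMorphism.Build (fps K) K fps_coef0 fps_coef0_additive.
HB.instance Definition _ :=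
  GRing.isMonoidMorphism.Build (fps K) K fps_coef0 fps_coef0_multiplicative.

(** One term of the geometric series is split off; this determines the coefficients recursively. *)
Lemma lambertM r : (0 < r)%N ->
  lambert K r = fpsX K ^+ r + fpsX K ^+ r * lambert K r.
Proof.
move=> r0; rewrite /lambert; set v := _^-1.
have vE : v = 1 + fpsX K ^+ r * v.
  by rewrite -[1](mulrV (lambert_unit K r0)) mulrBl mul1r subrK.
by rewrite {1}vE mulrDr mulr1.
Qed.

Lemma fpsX_over (S : subringClosed K) r : fpsX K ^+ r \in fps_over S.
Proof.
by apply: rpredX; apply/fps_overP => k /=; rewrite rpredMn ?rpred1.
Qed.

Lemma lambert_over (S : subringClosed K) r : (0 < r)%N ->
  lambert K r \in fps_over S.
Proof.
move=> r0; apply/fps_overP => k; elim/ltn_ind: k => k IHk.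
rewrite lambertM// fcoefD rpredD ?(fps_overP _ _ (fpsX_over S r))//.
(* [fpsX ^+ r] has no constant term, so the recursion only reaches coefficients below [k]. *)
rewrite fcoefM rpred_sum// => i _; case: (posnP i) => [->|i0].
  by rewrite fcoefX_lt// mul0r rpred0.
rewrite rpredM ?(fps_overP _ _ (fpsX_over S r))// IHk//.
by have := ltn_ord i; lia.
Qed.

Lemma fcoef_lfsum (F : nat -> fps K) k N :
  (forall l, (N <= l)%N -> fcoef (F l) k = 0) ->
  fcoef (fps_lfsum F) k = \sum_(l < N) fcoef (F l) k.
Proof.
move=> F0; rewrite [LHS]/=.
rewrite (fsbig_ord _ N (fun l => fcoef (F l) k)).
rewrite (fsbig_widen (`I_N)%classic [set: nat]%classic)// => l [_ /=] /negP.
by rewrite -leqNgt => /F0.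
Qed.

Lemma fcoef_lfsum_lambert (F : nat -> fps K) k :
  fcoef (fps_lfsum (fun l => F l * lambert K (2 * l + 1))) k =
  \sum_(l < k.+1) fcoef (F l * lambert K (2 * l + 1)) k.
Proof.
apply: fcoef_lfsum => l ltkl; rewrite fcoefM big1// => i _.
by rewrite [X in _ * X]fcoef_lambert_lt ?mulr0//; have := ltn_ord i; lia.
Qed.

End FpsOver.

(** * Square roots of natural numbers as cyclotomic integers *)

Section Cyclotomic.
Variable R : realType.

Lemma exists_prim_root (F : closedFieldType) n : (0 < n)%N -> n%:R != 0 :> F ->
  exists z : F, n.-primitive_root z.
Proof.
move=> n0 nF0; pose p : {poly F} := 'X^n - 1.
have [r Dp] := closed_field_poly_normal p.
rewrite (monicP _) ?monicXnsubC// scale1r in Dp.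
have rn1 : all n.-unity_root r by apply/allP=> z; rewrite -root_prod_XsubC -Dp.
have sz_r : (n < (size r).+1)%N.
  by rewrite -(size_prod_XsubC r id) -Dp size_XnsubC.
have [|z] := hasP (has_prim_root n0 rn1 _ sz_r); last by exists z.
by rewrite -separable_prod_XsubC -Dp separable_Xn_sub_1.
Qed.

(** Value at [1] of [(X^(n+1) - 1) / (X - 1)], computed once from its roots and once from its
    coefficients. *)
Lemma prod_one_sub_prim_root (F : fieldType) n (z : F) :
  n.+1.-primitive_root z -> \prod_(i < n) (1 - z ^+ i.+1) = n.+1%:R.
Proof.
move=> prz; have := factor_Xn_sub_1 prz.
rewrite big_nat_recl// expr0 subrX1 => /(mulfI (negbT (polyXsubC_eq0 1))).
move=> /(congr1 (horner^~ 1)); rewrite horner_prod horner_sum big_mkord.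
under eq_bigr do rewrite hornerXsubC.
move=> ->; under eq_bigr do rewrite hornerXn expr1n.
by rewrite sumr_const card_ord.
Qed.

Lemma subfield_unity n (z : R[i]) : (0 < n)%N -> z ^+ n = 1 ->
  z \in subfield_pred (@roots_of_unity R).
Proof.
by move=> n0 zn; apply: subfield_gen_sub; exists n => //; apply/unity_rootP.
Qed.

Lemma subfield_i : 'i%C \in subfield_pred (@roots_of_unity R).
Proof.
apply: (@subfield_unity 4) => //.
by rewrite (exprM _ 2 2) sqr_i sqrrN expr1n.
Qed.

(* For odd [N = 2h+1], pairing [k] with [N-k] in [N = \prod_(0<k<N) (1 - z^k)]
   and using [-z^-k = ('i z^(hk))^2] exhibits [N] as a square. *)
Lemma odd_square_cyclotomic h : exists2 w : R[i],
  w \in subfield_pred (@roots_of_unity R) & w ^+ 2 = (h.*2.+1)%:R.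
Proof.
have [] := @exists_prim_root R[i] h.*2.+1; rewrite ?pnatr_eq0//.
move=> z prz; have z1 := prim_expr_order prz.
have zS : z \in subfield_pred (@roots_of_unity R) by exact: subfield_unity z1.
exists (\prod_(k < h) ('i%C * z ^+ (h * k.+1) * (1 - z ^+ k.+1))).
  by rewrite rpred_prod// => k _; rewrite !rpredM ?subfield_i ?rpredB ?rpredX
    ?rpred1.
rewrite -(prod_one_sub_prim_root prz) -addnn big_split_ord/= -prodrXl.
rewrite [X in _ = _ * X](reindex_inj rev_ord_inj) -big_split/=.
apply: eq_bigr => k _; rewrite !exprMn sqr_i -!exprM.
set a := k.+1.
have -> : (h + (h - k.+1)).+1 = (h.*2.+1 - a)%N.
  by have := ltn_ord k; rewrite /a; lia.
have za : z ^+ (h.*2.+1 - a) * z ^+ a = 1.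
  by rewrite -exprD subnK// /a; have := ltn_ord k; lia.
have -> : z ^+ (h * a * 2) = z ^+ (h.*2.+1 - a).
  apply: (@mulIf _ (z ^+ a)).
    by apply: contra_eq_neq za => ->; rewrite mulr0 eq_sym oner_eq0.
  rewrite za -exprD (_ : (h * a * 2 + a = h.*2.+1 * a)%N) ?exprM ?z1 ?expr1n//.
  by rewrite -muln2; lia.
transitivity ((1 - z ^+ a) * (z ^+ (h.*2.+1 - a) * z ^+ a -
   z ^+ (h.*2.+1 - a))); last by rewrite za.
by ring.
Qed.

(** Induction by halving: odd numbers are covered by [odd_square_cyclotomic], and each factor [2] is
    the square of [z + z^-1] for a primitive eighth root of unity [z]. *)
Lemma nat_square_cyclotomic n : exists2 w : R[i],
  w \in subfield_pred (@roots_of_unity R) & w ^+ 2 = n%:R.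
Proof.
elim/ltn_ind: n => n IHn; case: (posnP n) => [->|n0].
  by exists 0; rewrite ?rpred0// expr0n.
rewrite -(odd_double_half n); case: (odd n) => /=.
  exact: odd_square_cyclotomic.
have [] := IHn n./2; first by lia.
move=> w wS w2.
have [||z prz] := @exists_prim_root R[i] 8; rewrite ?pnatr_eq0//.
have z8 := prim_expr_order prz.
have zS : z \in subfield_pred (@roots_of_unity R) by exact: subfield_unity z8.
have z4 : z ^+ 4 = -1.
  have : (z ^+ 4) ^+ 2 == 1 by rewrite -exprM z8.
  rewrite sqrf_eq1 => /orP[|/eqP//].
  by rewrite -(prim_order_dvd prz).
(* [z^7] is [z^-1], and [z^2 + z^-2 = 0] because [z^4 = -1]. *)
exists ((z + z ^+ 7) * w); first by rewrite rpredM// rpredD// rpredX.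
rewrite exprMn w2 add0n -muln2 natrM mulrC; congr (_ * _).
have -> : (z + z ^+ 7) ^+ 2 =
  z ^+ 4 ^+ 2 * 2 + z ^+ 2 * (1 + z ^+ 4 ^+ 3) by ring.
by rewrite z4; ring.
Qed.

Lemma sqrt_nat_cyclotomic n :
  cyclotomic_integers (Num.sqrt (n%:R : R))%:C%C.
Proof.
have sq : ((Num.sqrt (n%:R : R))%:C%C) ^+ 2 = n%:R :> R[i].
  by rewrite -rmorphXn sqr_sqrtr ?ler0n// rmorph_nat.
split.
  (* The real square root agrees up to sign with the element [w] of the cyclotomic field. *)
  have [w wS w2] := nat_square_cyclotomic n; apply/subfield_predP.
  have : w ^+ 2 == (Num.sqrt (n%:R : R))%:C%C ^+ 2 by rewrite sq w2.
  by rewrite eqf_sqr => /orP[] /eqP e; [rewrite -e | rewrite -rpredN -e].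
exists ('X^2 - n%:R%:P); first exact: monicXnsubC.
by rewrite /root rmorphB /= map_polyXn map_polyC/= !hornerE sq mulrz_nat subrr.
Qed.

End Cyclotomic.

(** * Dyadic values of the polynomials *)

Section Dyadic.
Variable F : numFieldType.
Implicit Types (k l m n : nat).

Definition dyadic : F -> bool :=
  fun x => `[< exists z e, x = (z : int)%:~R / 2 ^+ e >].

Lemma dyadicP x : reflect (exists z e, x = (z : int)%:~R / 2 ^+ e) (x \in dyadic).
Proof. exact: asboolP. Qed.

Let pow2_neq0 e : 2 ^+ e != 0 :> F.
Proof. by rewrite expf_neq0// pnatr_eq0. Qed.

Fact dyadic_closed : subring_closed dyadic.
Proof.
split.
- by apply/dyadicP; exists 1, 0%N; rewrite expr0 divr1.
- move=> x y /dyadicP[a [e ->]] /dyadicP[b [f ->]]; apply/dyadicP.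
  exists (a * 2 ^+ f - b * 2 ^+ e), (e + f)%N.
  rewrite rmorphB !rmorphM !rmorphXn /= exprD.
  by field; rewrite !pow2_neq0.
- move=> x y /dyadicP[a [e ->]] /dyadicP[b [f ->]]; apply/dyadicP.
  exists (a * b), (e + f)%N; rewrite rmorphM exprD /=.
  by field; rewrite !pow2_neq0.
Qed.

HB.instance Definition _ :=
  GRing.isSubringClosed.Build F dyadic dyadic_closed.

Lemma dyadic_half : 2^-1 \in dyadic.
Proof. by apply/dyadicP; exists 1, 1%N; rewrite div1r. Qed.

(** A power of [4] in the denominator has a power of [2] as its square root. *)
Lemma dyadic_ge0P x : x \in dyadic -> 0 <= x ->
  exists N e, x = N%:R / 4 ^+ e :> F.
Proof.
case/dyadicP=> z [e xE] x0; exists (`|z| * 2 ^ e)%N, e.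
have z0 : 0 <= z.
  by move: x0; rewrite xE pmulr_lge0 ?invr_gt0 ?exprn_gt0// ler0z.
rewrite xE natrM natrX -[X in X%:~R]gez0_abs// -pmulrn.
have -> : 4 = 2 * 2 :> F by rewrite -natrM.
rewrite exprMn.
by field; rewrite !pow2_neq0.
Qed.

(** [poch] is the rising factorial; [hpoch k] and [ubin k] are the [h_k] and [u_k] of the
    introduction. *)
Definition poch (x : F) n := \prod_(i < n) (x + i%:R).
Definition hpoch n := poch 2^-1 n.
Definition ubin n := hpoch n / n`!%:R.

Lemma pochS x n : poch x n.+1 = poch x n * (x + n%:R).
Proof. by rewrite /poch big_ord_recr. Qed.

Lemma poch_shift x n : poch x n.+1 = x * poch (x + 1) n.
Proof.
rewrite /poch big_ord_recl addr0; congr (_ * _); apply: eq_bigr => i _.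
by rewrite lift0 -natr1 [i%:R + _]addrC addrA.
Qed.

Lemma half_add_neq0 n : 2^-1 + n%:R != 0 :> F.
Proof. by rewrite gt_eqF// ltr_wpDr// invr_gt0. Qed.

Lemma hpoch_neq0 n : hpoch n != 0.
Proof. by apply/prodf_neq0 => i _; exact: half_add_neq0. Qed.

Lemma fact_neq0 n : n`!%:R != 0 :> F.
Proof. by rewrite pnatr_eq0 -lt0n fact_gt0. Qed.

Lemma ubin_neq0 n : ubin n != 0.
Proof. by rewrite mulf_neq0 ?hpoch_neq0// invr_neq0// fact_neq0. Qed.

Lemma ubinE n : ubin n = 'C(2 * n, n)%:R / 4 ^+ n.
Proof.
have four n' : 4 ^+ n' != 0 :> F by rewrite expf_neq0// pnatr_eq0.
have hE : hpoch n * 4 ^+ n * n`!%:R = (2 * n)`!%:R.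
  elim: n => [|n IHn]; first by rewrite /hpoch /poch big_ord0 !mulr1.
  rewrite mulnS !factS !natrM -IHn exprS [hpoch n.+1]pochS -/(hpoch n).
  by rewrite -!natr1; field.
have /(congr1 (fun k => k%:R : F)) := @bin_fact (2 * n) n ltac:(lia).
rewrite (_ : 2 * n - n = n)%N ?natrM -?hE; last by lia.
move=> e; apply: (mulIf (fact_neq0 n)); apply: (mulIf (fact_neq0 n)).
apply: (mulIf (four n)); rewrite /ubin.
transitivity (hpoch n * 4 ^+ n * n`!%:R); first by field; rewrite fact_neq0.
by rewrite -e; field; rewrite four.
Qed.

Lemma ubin_dyadic n : ubin n \in dyadic.
Proof.
have f : 4 = 2 * 2 :> F by rewrite -natrM.
rewrite ubinE rpredM ?rpred_nat// f.
by rewrite exprMn invfM -!exprVn rpredM// rpredX// dyadic_half.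
Qed.

Lemma natr_bin_left m k : k.+1%:R * 'C(m, k.+1)%:R = (m%:R - k%:R) * 'C(m, k)%:R :> F.
Proof.
case: (leqP k m) => [lekm|ltmk].
  by rewrite -natrB// -!natrM mul_bin_left.
by rewrite !bin_small ?mulr0// ltnW.
Qed.

(* [ubin m * 'C(m, k) / ubin k] is the binomial coefficient of [m - 1/2] over
   [m - k]; it obeys Pascal's rule. *)
Lemma ubin_bin_dyadic m k : ubin m * 'C(m, k)%:R / ubin k \in dyadic.
Proof.
elim: m k => [|m IHm] [|k].
- by rewrite bin0 mulr1 mulfV ?ubin_neq0// rpred1.
- by rewrite bin0n mulr0 mul0r rpred0.
- rewrite bin0 mulr1 /(ubin 0) /hpoch /poch big_ord0 !divr1.
  exact: ubin_dyadic.
suff -> : ubin m.+1 * 'C(m.+1, k.+1)%:R / ubin k.+1 =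
    ubin m * 'C(m, k)%:R / ubin k + ubin m * 'C(m, k.+1)%:R / ubin k.+1.
  by rewrite rpredD.
have k1 : k.+1%:R != 0 :> F by rewrite pnatr_eq0.
have m1 : m.+1%:R != 0 :> F by rewrite pnatr_eq0.
have e : 'C(m, k.+1)%:R = (m%:R - k%:R) * 'C(m, k)%:R / k.+1%:R :> F.
  by rewrite -natr_bin_left; field.
rewrite binS natrD e /ubin !factS !natrM /hpoch !pochS -/(hpoch m) -/(hpoch k).
by field; rewrite !fact_neq0 hpoch_neq0 -natrM !nat1r !pnatr_eq0.
Qed.

(** The right side is the binomial coefficient of [m + n - 1/2] over [n], the shape in which
    [ubin_bin_dyadic] is needed at negative nodes. *)
Lemma ubin_bin m n : ubin (m + n) * 'C(m + n, m)%:R / ubin m =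
  hpoch (m + n) / (hpoch m * n`!%:R).
Proof.
have /(congr1 (fun k => k%:R : F)) := bin_fact (leq_addr n m).
rewrite addKn !natrM => e.
have -> : 'C(m + n, m)%:R = (m + n)`!%:R / (m`!%:R * n`!%:R) :> F.
  by rewrite -e; field; rewrite !fact_neq0.
by rewrite /ubin; field; rewrite !fact_neq0 !hpoch_neq0.
Qed.

Definition ynode l : F := 2^-1 + 2 * l%:R.

(* With [x = -'i y], the product in the definition of [calP] runs over the
   factors [-(y / 2 - 1 / 4 - i)]. *)
Definition ffpoly k : {poly F} :=
  \prod_(i < k) (2^-1 *: 'X - (4^-1 + i%:R)%:P).

(** The hypergeometric sum [2F1(-m, 1/4 - X/2; 1/2; 2)]: up to normalization and rotation of the
    variable, a Meixner-Pollaczek polynomial. *)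
Definition Qpoly m : {poly F} :=
  \sum_(k < m.+1) ('C(m, k)%:R * 2 ^+ k / hpoch k) *: ffpoly k.

Lemma ffpoly_ynode k l : (ffpoly k).[ynode l] = (k`! * 'C(l, k))%:R.
Proof.
rewrite mulnC bin_ffact /ffpoly horner_prod.
elim: k => [|k IHk]; first by rewrite big_ord0 ffactn0.
rewrite big_ord_recr/= IHk ffactnSr natrM !hornerE.
case: (leqP k l) => [lekl|ltlk]; last by rewrite ffact_small ?mul0r.
by rewrite natrB// /ynode; congr (_ * _); field.
Qed.

(** At [- y_l] the argument [X/2 - 1/4] is [- l - 1/2] (at [y_l] it is [l]), so the falling
    factorial becomes a signed rising one. *)
Lemma ffpoly_ynodeN k l :
  (ffpoly k).[- ynode l] = (-1) ^+ k * hpoch (l + k) / hpoch l.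
Proof.
rewrite /ffpoly horner_prod.
elim: k => [|k IHk]; first by rewrite big_ord0 expr0 mul1r addn0 mulfV ?hpoch_neq0.
rewrite big_ord_recr/= IHk !hornerE addnS /hpoch pochS -/(hpoch _) exprS natrD.
by rewrite -/(hpoch l) /ynode; field; rewrite hpoch_neq0.
Qed.

(** The summand is symmetric in [m] and [l], so either [ubin m] or [ubin l] can absorb the
    denominator [ubin k]. *)
Lemma Qpoly_ynode m l : (Qpoly m).[ynode l] =
  \sum_(k < m.+1) 2 ^+ k * 'C(m, k)%:R * 'C(l, k)%:R / ubin k.
Proof.
rewrite horner_sum; apply: eq_bigr => k _; rewrite hornerZ ffpoly_ynode natrM.
by rewrite /ubin; field; rewrite hpoch_neq0 fact_neq0.
Qed.

Lemma Qpoly_ynodeN m l : (Qpoly m).[- ynode l] =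
  \sum_(k < m.+1) (- 2) ^+ k * 'C(m, k)%:R * (hpoch (l + k) / (hpoch k * hpoch l)).
Proof.
rewrite horner_sum; apply: eq_bigr => k _; rewrite hornerZ ffpoly_ynodeN.
by rewrite [(- 2) ^+ k]exprNn; field; rewrite !hpoch_neq0.
Qed.

Lemma ubin_Qpoly_dyadic m l : ubin m * (Qpoly m).[ynode l] \in dyadic.
Proof.
rewrite Qpoly_ynode mulr_sumr rpred_sum// => k _.
rewrite [X in X \in _](_ : _ = 2 ^+ k * 'C(l, k)%:R * (ubin m * 'C(m, k)%:R / ubin k)).
  apply: rpredM; last exact: ubin_bin_dyadic.
  by rewrite rpredM ?rpredX ?rpred_nat.
by field; rewrite ubin_neq0.
Qed.

Lemma ubin_node_Qpoly_dyadic m l : ubin l * (Qpoly m).[ynode l] \in dyadic.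
Proof.
rewrite Qpoly_ynode mulr_sumr rpred_sum// => k _.
rewrite [X in X \in _](_ : _ = 2 ^+ k * 'C(m, k)%:R * (ubin l * 'C(l, k)%:R / ubin k)).
  apply: rpredM; last exact: ubin_bin_dyadic.
  by rewrite rpredM ?rpredX ?rpred_nat.
by field; rewrite ubin_neq0.
Qed.

Lemma ubin_QpolyN_dyadic m l : ubin m * (Qpoly m).[- ynode l] \in dyadic.
Proof.
rewrite Qpoly_ynodeN mulr_sumr rpred_sum// => k _.
rewrite [X in X \in _](_ : _ = (- 2) ^+ k * (ubin m * 'C(m, k)%:R / ubin k) *
                     (hpoch (l + k) / (hpoch l * k`!%:R))).
  rewrite -ubin_bin; apply: rpredM; last exact: ubin_bin_dyadic.
  apply: rpredM; last exact: ubin_bin_dyadic.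
  by rewrite rpredX// rpredN rpred_nat.
by rewrite [ubin k]/ubin; field; rewrite !hpoch_neq0 fact_neq0.
Qed.

Lemma ubin_node_QpolyN_dyadic m l : ubin l * (Qpoly m).[- ynode l] \in dyadic.
Proof.
rewrite Qpoly_ynodeN mulr_sumr rpred_sum// => k _.
rewrite [X in X \in _](_ : _ = (- 2) ^+ k * 'C(m, k)%:R *
                     (hpoch (k + l) / (hpoch k * l`!%:R))).
  rewrite -ubin_bin; apply: rpredM; last exact: ubin_bin_dyadic.
  by rewrite rpredM ?rpredX ?rpredN ?rpred_nat.
by rewrite /ubin [(l + k)%N]addnC; field; rewrite !hpoch_neq0 fact_neq0.
Qed.

End Dyadic.

(** * Orthogonality *)

Section Moments.
Variable F : numFieldType.
Implicit Types (p q : {poly F}) (mu : nat -> F).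

(** The linear functional on polynomials with moment sequence [mu]. *)
Definition mom mu q := \sum_(j < size q) q`_j * mu j.

Lemma mom_widen mu q N : (size q <= N)%N ->
  mom mu q = \sum_(j < N) q`_j * mu j.
Proof.
move=> leqN; rewrite /mom (big_ord_widen N (fun j => q`_j * mu j))// big_mkcond.
apply: eq_bigr => j _; case: ifPn => //; rewrite -leqNgt => /(nth_default 0) ->.
by rewrite mul0r.
Qed.

Fact mom_linear mu : linear_for *%R (mom mu).
Proof.
move=> a p q; pose N := maxn (size p) (size q).
rewrite !(@mom_widen _ _ N) ?leq_maxl ?leq_maxr//; last first.
  by rewrite (leq_trans (size_polyD _ _))// geq_max leq_maxr
             (leq_trans (size_scale_leq _ _))// leq_maxl.
rewrite mulr_sumr -big_split; apply: eq_bigr => j _ /=.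
by rewrite coefD coefZ mulrDl mulrA.
Qed.

HB.instance Definition _ mu :=
  GRing.isLinear.Build F {poly F} F *%R (mom mu) (mom_linear mu).

Lemma momXn mu j : mom mu 'X^j = mu j.
Proof.
rewrite (@mom_widen _ _ j.+1) ?size_polyXn// big_ord_recr/= big1 ?add0r.
  by rewrite coefXn eqxx mul1r.
by move=> i _; rewrite coefXn ltn_eqF ?mul0r.
Qed.

Lemma mom_horner (y : F) p : mom (fun j => y ^+ j) p = p.[y].
Proof. by rewrite horner_coef. Qed.

Lemma eq_mom mu mu' p : mu =1 mu' -> mom mu p = mom mu' p.
Proof. by move=> e; apply: eq_bigr => j _; rewrite e. Qed.

Lemma momD mu mu' p : mom (fun j => mu j + mu' j) p = mom mu p + mom mu' p.
Proof. by rewrite -big_split; apply: eq_bigr => j _ /=; rewrite mulrDr. Qed.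

Lemma momZ c mu p : mom (fun j => c * mu j) p = c * mom mu p.
Proof. by rewrite mulr_sumr; apply: eq_bigr => j _; rewrite mulrCA. Qed.

Lemma momXM mu q : mom mu ('X * q) = mom (fun j => mu j.+1) q.
Proof.
rewrite (@mom_widen _ _ (size q).+1); last first.
  by rewrite (leq_trans (size_polyMleq _ _))// size_polyX.
rewrite big_ord_recl coefXM mul0r add0r; apply: eq_bigr => j _.
by rewrite coefXM lift0.
Qed.

(** Turns a two-sided product with a Hankel matrix into one value of the functional. The signs,
    which will come from powers of ['i], account for the substitution of [- 'X]. *)
Lemma mom_bilinear mu p q n : (size p <= n.+1)%N -> (size q <= n.+1)%N ->
  \sum_(a < n.+1) \sum_(b < n.+1) p`_a * ((-1) ^+ b * q`_b) * mu (a + b)%N =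
  mom mu (p * (q \Po - 'X)).
Proof.
move=> sp sq.
have pE : p = \sum_(a < n.+1) p`_a *: 'X^a.
  rewrite -poly_def; apply/polyP => i; rewrite coef_poly.
  by case: ltnP => // /(leq_trans sp) /(nth_default 0).
have qE : q \Po - 'X = \sum_(b < n.+1) ((-1) ^+ b * q`_b) *: 'X^b.
  rewrite comp_polyE (big_ord_widen n.+1 (fun i => q`_i *: (- 'X) ^+ i))//.
  rewrite big_mkcond; apply: eq_bigr => b _; case: ltnP => [_|/(nth_default 0)->].
    by rewrite -scaleN1r exprZn scalerA mulrC.
  by rewrite mulr0 scale0r.
rewrite {2}pE qE mulr_suml linear_sum; apply: eq_bigr => a _.
rewrite mulr_sumr linear_sum; apply: eq_bigr => b _.
by rewrite -scalerAl -scalerAr -exprD !linearZ /= momXn mulrA.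
Qed.

(** The derivation transported to polynomials. With [F = (e^x + e^-x)^(-1/2)] and
    [s = e^x / (e^x + e^-x)] one has [F' = F (1/2 - s)] and [s' = 2 s (1 - s)], so the derivative of
    [F p(s)] is [F (Top p)(s)]. *)
Definition Top p : {poly F} :=
  (2^-1%:P - 'X) * p + 2 *: ('X * (1 - 'X) * p^`()).

Fact Top_linear : linear Top.
Proof.
move=> a p q; rewrite /Top derivD derivZ -!mul_polyC.
by ring.
Qed.

HB.instance Definition _ :=
  GRing.isLinear.Build F {poly F} {poly F} *:%R Top Top_linear.

Lemma iter_Top_linear j : linear (iter j Top).
Proof. by elim: j => [|j IHj] a p q //=; rewrite IHj linearP. Qed.

(** The [j]-th derivative of [F p(s)] at [x = 0], where [s = 1/2], divided by [F(0)]. *)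
Definition muT p j := (iter j Top p).[2^-1].

(** Multiplying the argument by ['X] shifts the moments, which amounts to applying [Top] to [p]
    first; a linear factor can thus be absorbed into [p]. *)
Lemma mom_muT_factor a b c p p' q : a *: Top p + b *: p = c *: p' ->
  mom (muT p) ((a *: 'X + b%:P) * q) = c * mom (muT p') q.
Proof.
move=> e; rewrite mulrDl -scalerAl mul_polyC linearD !linearZ /= momXM.
rewrite -!momZ -momD; apply: eq_mom => j; rewrite /muT iterSr.
have itD r r' : iter j Top (r + r') = iter j Top r + iter j Top r'.
  by have := iter_Top_linear j 1 r r'; rewrite !scale1r.
have itZ d r : iter j Top (d *: r) = d *: iter j Top r.
  have it0 : iter j Top 0 = 0 by apply: (@addrI _ (iter j Top 0)); rewrite -itD !addr0.
  by have := iter_Top_linear j d r 0; rewrite it0 !addr0.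
by rewrite -!hornerZ -hornerD -!itZ -itD e.
Qed.

Definition bpoly k j : {poly F} := 'X ^+ k * (1 - 'X) ^+ j.

Lemma Top_bpoly k j : Top (bpoly k j) =
  bpoly k j * ((2^-1 + 2 * k%:R)%:P - (1 + 2 * k%:R + 2 * j%:R) *: 'X).
Proof.
have dX : 'X * ('X ^+ k)^`() = k%:R *: 'X ^+ k :> {poly F}.
  by case: k => [|k]; rewrite derivXn/= ?mulr0n ?mulr0 ?scale0r// -scaler_nat
    -scalerAr -exprS.
have dY : (1 - 'X) * ((1 - 'X) ^+ j)^`() = - j%:R *: (1 - 'X) ^+ j :> {poly F}.
  rewrite deriv_exp derivB derivC derivX sub0r mulN1r.
  case: j => [|j]; rewrite ?mulr0n ?mulr0 ?oppr0 ?scale0r//.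
  by rewrite -scaler_nat -scalerAr mulrN -exprS scalerN scaleNr.
rewrite /Top /bpoly derivM.
have -> : 'X * (1 - 'X) * (('X ^+ k)^`() * (1 - 'X) ^+ j +
    'X ^+ k * ((1 - 'X) ^+ j)^`()) =
    ('X * ('X ^+ k)^`()) * (1 - 'X) ^+ j * (1 - 'X) +
    ((1 - 'X) * ((1 - 'X) ^+ j)^`()) * 'X ^+ k * 'X :> {poly F} by ring.
rewrite dX dY -!mul_polyC !(polyCD, polyCM, polyCN, polyC_natr).
by ring.
Qed.

Definition ffpolyN k := ffpoly F k \Po - 'X.

Lemma ffpolyS k : ffpoly F k.+1 = ffpoly F k * (2^-1 *: 'X - (4^-1 + k%:R)%:P).
Proof. by rewrite /ffpoly big_ord_recr. Qed.

Lemma ffpolyNS k :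
  ffpolyN k.+1 = ffpolyN k * (- 2^-1 *: 'X - (4^-1 + k%:R)%:P).
Proof.
rewrite /ffpolyN ffpolyS comp_polyM comp_polyB comp_polyZ comp_polyX comp_polyC.
by rewrite scalerN scaleNr.
Qed.

(** The linear factors are absorbed one at a time. By [Top_bpoly], a factor of [ffpolyN] raises the
    exponent of [1 - 'X], a factor of [ffpoly] that of ['X], and each contributes [-(1/2 + k + j)]
    for the current exponents. *)
Lemma mom_ffpolyM k j q : mom (muT 1) (ffpoly F k * (ffpolyN j * q)) =
  (-1) ^+ (k + j) * hpoch F (k + j) * mom (muT (bpoly k j)) q.
Proof.
pose h : {poly F} := (2^-1)%:P.
have h2 : 1 - 2 * h = 0.
  by rewrite -[2]polyC_natr -polyCM mulfV ?pnatr_eq0// subrr.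
have q4 : 4^-1 = 2^-1 * 2^-1 :> F by rewrite -invfM -natrM.
elim: k j q => [|k IHk] j q.
  rewrite /ffpoly big_ord0 mul1r add0n.
  elim: j q => [|j IHj] q.
    by rewrite /ffpolyN /ffpoly big_ord0 comp_polyC mul1r /hpoch /poch big_ord0
      !mul1r /bpoly !expr0 mulr1.
  rewrite ffpolyNS -mulrA IHj -polyCN.
  rewrite (@mom_muT_factor _ _ (- (2^-1 + j%:R)) _ (bpoly 0 j.+1)).
    by rewrite /hpoch pochS -/(hpoch F j) exprS; ring.
  rewrite Top_bpoly /bpoly !expr0 exprS !mul1r q4.
  rewrite -!mul_polyC !(polyCD, polyCM, polyCN, polyC_natr) -/h.
  (* A multiple of [1 - 2 * h = 0] is added so that both sides agree identically in [h]. *)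
  rewrite -[RHS]addr0 -(mul0r ((1 - 'X) ^+ j * (h - j%:R * 'X))) -h2.
  by ring.
rewrite ffpolyS -mulrA [X in ffpoly F k * X]mulrCA IHk -polyCN.
rewrite (@mom_muT_factor _ _ (- (2^-1 + (k + j)%:R)) _ (bpoly k.+1 j)).
  by rewrite addSn /hpoch pochS -/(hpoch F _) exprS; ring.
rewrite Top_bpoly /bpoly exprS q4 natrD.
rewrite -!mul_polyC !(polyCD, polyCM, polyCN, polyC_natr) -/h.
rewrite -[RHS]addr0 -(mul0r (- ('X ^+ k * (1 - 'X) ^+ j *
  (k%:R - (k%:R + j%:R) * 'X)))) -h2.
by ring.
Qed.

Definition gram m n := mom (muT 1) (Qpoly F m * (Qpoly F n \Po - 'X)).

(** By [mom_ffpolyM]; the value [2^-(k+j)] of [bpoly k j] at [1/2] cancels the powers of [2] in the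
    two polynomials. *)
Lemma gramE m n : gram m n = \sum_(k < m.+1) \sum_(j < n.+1)
  (-1) ^+ (k + j) * 'C(m, k)%:R * 'C(n, j)%:R *
  (hpoch F (k + j) / (hpoch F k * hpoch F j)).
Proof.
rewrite /gram /Qpoly mulr_suml !linear_sum; apply: eq_bigr => k _.
rewrite mulr_sumr linear_sum; apply: eq_bigr => j _.
rewrite /= comp_polyZ -scalerAl -scalerAr !linearZ /=.
rewrite -[ffpoly F j \Po - 'X]mulr1 mom_ffpolyM -(expr0 'X) momXn /muT /=.
rewrite /bpoly hornerM !horner_exp hornerD hornerN hornerX hornerC.
have -> : 1 - 2^-1 = 2^-1 :> F by field.
rewrite exprD -exprD !exprVn exprD.
by field; rewrite !hpoch_neq0 !expf_neq0 ?pnatr_eq0.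
Qed.

Lemma gramC m n : gram m n = gram n m.
Proof.
rewrite !gramE exchange_big; apply: eq_bigr => j _; apply: eq_bigr => k _.
by rewrite [(k + j)%N]addnC [hpoch F k * _]mulrC; ring.
Qed.

(* The Chu-Vandermonde sum, in a form that is proved by taking iterated
   differences in [s]. *)
Lemma alt_sum_hpoch m s j :
  \sum_(k < m.+1) (-1) ^+ k * 'C(m, k)%:R *
     (hpoch F (s + k + j) / hpoch F (s + k)) =
  hpoch F (s + j) / hpoch F s * poch (- j%:R : F) m / poch (2^-1 + s%:R : F) m.
Proof.
have pz i m' : poch (2^-1 + i%:R : F) m' != 0.
  by apply/prodf_neq0 => i' _; rewrite -addrA -natrD half_add_neq0.
elim: m s => [|m IHm] s.
  by rewrite big_ord1 expr0 bin0 !mul1r addn0 /poch !big_ord0 mulr1 divr1.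
rewrite big_ord_recl; under eq_bigr do rewrite lift0 binS natrD mulrDr mulrDl.
rewrite big_split /= expr0 bin0 !mul1r addn0 addrA.
have -> : hpoch F (s + j) / hpoch F s + \sum_(i < m.+1) (-1) ^+ i.+1 *
   'C(m, i.+1)%:R * (hpoch F (s + i.+1 + j) / hpoch F (s + i.+1)) =
   \sum_(i < m.+1) (-1) ^+ i * 'C(m, i)%:R *
   (hpoch F (s + i + j) / hpoch F (s + i)).
  rewrite [RHS]big_ord_recl /= expr0 bin0 !mul1r addn0; congr (_ + _).
  under [RHS]eq_bigr do rewrite /bump add1n.
  by rewrite big_ord_recr /= bin_small// mulr0 mul0r addr0.
have -> : \sum_(i < m.+1) (-1) ^+ i.+1 * 'C(m, i)%:R *
   (hpoch F (s + i.+1 + j) / hpoch F (s + i.+1)) =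
   - \sum_(i < m.+1) (-1) ^+ i * 'C(m, i)%:R *
   (hpoch F (s.+1 + i + j) / hpoch F (s.+1 + i)).
  by rewrite -sumrN; apply: eq_bigr => i _; rewrite exprS addSnnS; ring.
rewrite !IHm addSn /hpoch !pochS -!/(hpoch F _) natrD.
have := poch_shift (2^-1 + s%:R : F) m; rewrite pochS => e.
have {e} -> : poch (2^-1 + s.+1%:R : F) m =
    poch (2^-1 + s%:R : F) m * (2^-1 + s%:R + m%:R) / (2^-1 + s%:R).
  by rewrite e -[s.+1%:R]natr1 addrA; field; rewrite -natrM nat1r pnatr_eq0.
by field; rewrite pz hpoch_neq0 -!natrM -addrA -natrD !nat1r !pnatr_eq0.
Qed.

Lemma poch_oppn_small j m : (j < m)%N -> poch (- j%:R : F) m = 0.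
Proof.
by move=> ltjm; rewrite /poch (bigD1 (Ordinal ltjm))//= addNr mul0r.
Qed.

Lemma poch_oppn m : poch (- m%:R : F) m = (-1) ^+ m * m`!%:R.
Proof.
elim: m => [|m IHm]; first by rewrite /poch big_ord0 mulr1.
rewrite poch_shift (_ : - m.+1%:R + 1 = - m%:R); last by rewrite -natr1 opprD addrNK.
by rewrite IHm factS natrM exprS; ring.
Qed.

(** Summing over [k] first produces [poch (- j) m], which vanishes for [j < m]; as [j <= n <= m],
    only [j = n = m] can survive. *)
Lemma gram_leq m n : (n <= m)%N ->
  gram m n = if m == n then m`!%:R / hpoch F m else 0.
Proof.
move=> lenm; rewrite gramE exchange_big /=.
transitivity (\sum_(j < n.+1) (-1) ^+ j * 'C(n, j)%:R *
    (poch (- j%:R : F) m / hpoch F m)).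
  apply: eq_bigr => j _; have := alt_sum_hpoch m 0 j.
  rewrite addr0 => e.
  transitivity ((-1) ^+ j * 'C(n, j)%:R / hpoch F j * \sum_(k < m.+1)
    (-1) ^+ k * 'C(m, k)%:R * (hpoch F (0 + k + j) / hpoch F (0 + k))).
    rewrite mulr_sumr; apply: eq_bigr => k _; rewrite add0n exprD.
    by field; rewrite !hpoch_neq0.
  rewrite e add0n {1}/(hpoch F 0) {1}/poch big_ord0 -/(hpoch F m).
  by field; rewrite !hpoch_neq0.
rewrite big_ord_recr /= big1 ?add0r; last first.
  move=> j _; rewrite poch_oppn_small ?mul0r ?mulr0//.
  exact: leq_trans (ltn_ord j) lenm.
case: eqVneq => [->|nemn]; last first.
  by rewrite poch_oppn_small ?mul0r ?mulr0// ltn_neqAle eq_sym nemn.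
by rewrite binn mulr1 poch_oppn !mulrA -exprMn mulN1r opprK expr1n mul1r.
Qed.

Lemma gram_diag m n : gram m n = if m == n then m`!%:R / hpoch F m else 0.
Proof.
case: (leqP n m) => [/gram_leq//|/ltnW lemn]; rewrite gramC gram_leq// eq_sym.
by case: eqP => // ->.
Qed.

(* [Top] anticommutes with the substitution of [1 - 'X] for ['X], whose fixed
   point is [1 / 2]. *)
Lemma muT1_odd j : odd j -> muT 1 j = 0.
Proof.
have Tr p : Top (p \Po (1 - 'X)) = - (Top p \Po (1 - 'X)).
  rewrite /Top deriv_comp derivB derivC derivX sub0r.
  rewrite comp_polyD comp_polyZ !comp_polyM !comp_polyB !comp_polyX !comp_polyC.
  rewrite -!mul_polyC.
  have h2 : 1 - 2 * (2^-1)%:P = 0 :> {poly F}.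
    by rewrite -[2]polyC_natr -polyCM mulfV ?pnatr_eq0// subrr.
  rewrite polyC1 -[RHS]addr0 -(mul0r (- (p \Po (1 - 'X)))) -h2 polyC_natr.
  by ring.
have itr i : iter i Top 1 \Po (1 - 'X) = (-1) ^+ i *: iter i Top 1.
  elim: i => [|i IHi] /=; first by rewrite comp_polyC expr0 scale1r.
  by rewrite -[LHS]opprK -Tr IHi linearZ exprS mulN1r scaleNr.
move=> oj; have := congr1 (horner^~ 2^-1) (itr j).
rewrite hornerZ -signr_odd oj expr1 mulN1r horner_comp !hornerE.
have -> : 1 - 2^-1 = 2^-1 :> F by field.
rewrite -/(muT 1 j) => /eqP; rewrite -addr_eq0 -mulr2n mulrn_eq0 /=.
by move/eqP.
Qed.

End Moments.

(** * Taylor coefficients of [(e^x + e^-x)^(-1/2)] *)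

Section Derivatives.
Import numFieldNormedType.Exports.
Variable R : realType.

Definition base (x : R) := (expR x + expR (- x)) `^ (- (1 / 2)).
Definition sigm (x : R) := expR x / (expR x + expR (- x)).

Let den_gt0 (x : R) : 0 < expR x + expR (- x).
Proof. by rewrite addr_gt0 ?expR_gt0. Qed.

Let is_derive_den (x : R) :
  is_derive x 1 (fun t => expR t + expR (- t)) (expR x - expR (- x)).
Proof.
have d : is_derive x 1 (expR \o -%R) (expR (- x) * - 1).
  exact: is_derive1_comp.
by apply: is_derive_eq; rewrite mulrN1.
Qed.

Lemma is_derive_base (x : R) :
  is_derive x 1 base (base x * (2^-1 - sigm x)).
Proof.
have := @is_derive1_comp R ((@powR R)^~ (- (1 / 2))) (fun t => expR t + expR (- t))
  x _ _ (is_derive1_powR (- (1 / 2)) (den_gt0 x)) (is_derive_den x).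
move=> d; apply: (@is_derive_eq _ _ _ base x 1 _ _ d).
rewrite powRD; last by rewrite (gt_eqF (den_gt0 x)) implybT.
rewrite powR_inv1 ?(ltW (den_gt0 x))// /base /sigm.
by field; rewrite (gt_eqF (den_gt0 x)).
Qed.

Lemma is_derive_sigm (x : R) :
  is_derive x 1 sigm (2 * (sigm x * (1 - sigm x))).
Proof.
have den0 := lt0r_neq0 (den_gt0 x).
pose den (t : R) := expR t + expR (- t).
have dV : is_derive x 1 (fun t => (den t)^-1) _ :=
  @is_deriveV R den x _ 1 den0 (is_derive_den x).
have dM := is_deriveM (is_derive_expR x) dV.
apply: (@is_derive_eq _ _ _ sigm x 1 _ _ dM).
rewrite /sigm /den /GRing.scale /=.
have eN : expR (- x) = (expR x)^-1 by rewrite expRN.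
move: den0; rewrite eN; set e := expR x => den0.
have e0 : e != 0 by rewrite gt_eqF// expR_gt0.
by field; rewrite e0 /= lt0r_neq0// addr_gt0 ?mulr_gt0 ?expR_gt0.
Qed.

(** At [x = 0] this identifies the derivatives in [c0] with [base 0] times the moments [muT 1]. *)
Lemma derive1n_base j (x : R) :
  derive1n j base x = base x * (iter j (@Top R) 1).[sigm x].
Proof.
elim: j x => [|j IHj] x; first by rewrite /= hornerC mulr1.
have -> : derive1n j.+1 base = derive1 (fun t => base t * (iter j (@Top R) 1).[sigm t]).
  by rewrite /derive1n iterS; congr derive1; apply/funext.
rewrite derive1E iterS.
set p := iter _ _ _.
have dp : is_derive x (1 : R) (horner p \o sigm) (p^`().[sigm x] * _) :=
  is_derive1_comp (is_derive_poly p (sigm x)) (is_derive_sigm x).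
have dM := is_deriveM (is_derive_base x) dp.
rewrite (@derive_val _ _ _ _ _ _ _ dM) /Top /GRing.scale /=.
rewrite !(hornerD, hornerN, hornerM, hornerZ, hornerX, hornerC).
by ring.
Qed.
End Derivatives.

(** * Matrix elements and traces *)

Section ExteriorTrace.
Variables (K : comUnitRingType) (d : nat).
Implicit Types (A B : 'M[K]_d) (w : 'I_d -> K).

(** [B] is the conjugate of [A] by [diag w], stated without inverses; each wedge factor exchanges
    one [w c] for the weights of the basis vectors involved. *)
Lemma wedge_seq_conj A B w (s : seq 'I_d) (U : {set 'I_d}) :
  (forall i j, B i j * w j = w i * A i j) ->
  wedge_seq [seq col i B | i <- s] U * \prod_(i <- s) w i =
  (\prod_(i in U) w i) * wedge_seq [seq col i A | i <- s] U.
Proof.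
move=> BA; elim: s U => [|c s IHs] U.
  rewrite /wedge_seq /= big_nil mulr1 !ffunE.
  case: eqP => [/eqP|_]; last by rewrite mulr0.
  by rewrite cards_eq0 => /eqP ->; rewrite big_set0 mul1r.
rewrite /wedge_seq /= !ffunE big_cons mulr_suml mulr_sumr.
apply: eq_bigr => S sSU; rewrite -/(wedge_seq _) -/(wedge_seq _).
have -> : ext_vec (col c A) S = \sum_(i | S == finset.set1 i) A i c.
  by rewrite ffunE; apply: eq_bigr => i _; rewrite mxE.
have -> : ext_vec (col c B) S = \sum_(i | S == finset.set1 i) B i c.
  by rewrite ffunE; apply: eq_bigr => i _; rewrite mxE.
have prodU : \prod_(i in U) w i = \prod_(i in S) w i * \prod_(i in U :\: S) w i.
  by rewrite (big_setID S) /= (finset.setIidPr sSU).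
have e : (\sum_(i | S == finset.set1 i) B i c) * w c =
         \prod_(i in S) w i * \sum_(i | S == finset.set1 i) A i c.
  rewrite mulr_suml mulr_sumr; apply: eq_bigr => i /eqP ->.
  by rewrite big_set1 BA.
set b := \sum_(i | _) B i c in e *; set a := \sum_(i | _) A i c in e *.
have := IHs (U :\: S); set x := wedge_seq _ _; set y := wedge_seq _ _ => xy.
rewrite -/x -/y prodU.
transitivity ((-1) ^+ inversions S (U :\: S) * (b * w c) * (x * \prod_(i <- s) w i)).
  by ring.
by rewrite e xy; ring.
Qed.

(** On the diagonal the weights on the two sides of [wedge_seq_conj] are the same unit. *)
Lemma tr_extpow_conj m A B w : (forall i, w i \is a GRing.unit) ->
  (forall i j, B i j * w j = w i * A i j) ->
  \tr (extpow m B) = \tr (extpow m A).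
Proof.
move=> wU BA; apply: eq_bigr => a _; rewrite !mxE.
set U : {set 'I_d} := enum_val a.
have := wedge_seq_conj (enum U) U BA; rewrite big_enum mulrC => /mulrI; apply.
by rewrite rpred_prod.
Qed.

Lemma tr_extpow_over (S : subringClosed K) m A : (forall i j, A i j \in S) ->
  \tr (extpow m A) \in S.
Proof.
move=> SA; rewrite rpred_sum// => a _; rewrite mxE.
suff: forall (s : seq 'I_d) U, wedge_seq [seq col i A | i <- s] U \in S by apply.
elim=> [|c s IHs] U; rewrite /wedge_seq /= ffunE.
  by rewrite rpred_nat.
rewrite rpred_sum// => T _; rewrite -/(wedge_seq _) !rpredM ?rpredX ?rpredN1//.
by rewrite ffunE rpred_sum// => i _; rewrite mxE.
Qed.

End ExteriorTrace.

(** * Coefficients of the matrix elements of the operators *)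

Section Entries.
Variable R : realType.
Local Notation S := (subring_pred [set ((Num.sqrt 2)^-1)%:C%C : R[i]]%classic).
Local Notation Z := (subring_pred (@cyclotomic_integers R `|` [set 2^-1])%classic).
Local Notation sqrt2 := (Num.sqrt 2 : R).

Lemma sqrt2_neq0 : sqrt2 != 0.
Proof. by rewrite gt_eqF// sqrtr_gt0. Qed.

Lemma sqrt2V_over : (sqrt2^-1)%:C%C \in S.
Proof. exact: subring_gen_sub. Qed.

Lemma sqrt2_over : sqrt2%:C%C \in S.
Proof.
have e : sqrt2 = 2 * sqrt2^-1.
  by rewrite -{2}(@sqr_sqrtr _ 2)// expr2 mulfK// sqrt2_neq0.
rewrite [X in X%:C%C \in _]e rmorphM rmorph_nat.
by rewrite rpredM ?rpred_nat//; exact: sqrt2V_over.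
Qed.

Lemma half_over : (2^-1 : R)%:C%C \in S.
Proof.
have -> : (2^-1 : R) = sqrt2^-1 ^+ 2 by rewrite exprVn sqr_sqrtr.
by rewrite rmorphXn rpredX//; exact: sqrt2V_over.
Qed.

Lemma dyadic_over (x : R) : x \in @dyadic R -> x%:C%C \in S.
Proof.
case/dyadicP=> z [e ->]; rewrite rmorphM rmorph_int -exprVn rmorphXn.
by rewrite rpredM ?rpred_int// rpredX//; exact: half_over.
Qed.

Lemma half_Zcyc : (2^-1 : R)%:C%C \in Z.
Proof. by apply: subring_gen_sub; right; rewrite fmorphV rmorph_nat. Qed.

Lemma sqrt_nat_Zcyc n : (Num.sqrt (n%:R : R))%:C%C \in Z.
Proof. by apply: subring_gen_sub; left; exact: sqrt_nat_cyclotomic. Qed.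

Lemma sqrt_dyadic_Zcyc (x : R) : x \in @dyadic R -> 0 <= x ->
  (Num.sqrt x)%:C%C \in Z.
Proof.
move=> xD x0; have [N [e ->]] := dyadic_ge0P xD x0.
have -> : (4 : R) ^+ e = (2 ^+ e) ^+ 2.
  by rewrite -exprM mulnC exprM -[2 ^+ 2]natrX.
rewrite sqrtrM ?ler0n// sqrtrV ?exprn_ge0// sqrtr_sqr ger0_norm ?exprn_ge0//.
rewrite -exprVn rmorphM rmorphXn; apply: rpredM.
  exact: sqrt_nat_Zcyc.
exact/rpredX/half_Zcyc.
Qed.

(** These coefficients are real ([lamE]), so computations can be done in [R] and embedded
    afterwards. *)
Definition lam l k : R := complex.Re (fcoef (lambert R[i] (2 * l + 1)) k).

Lemma lamE l k : fcoef (lambert R[i] (2 * l + 1)) k = (lam l k)%:C%C.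
Proof.
rewrite /lam RRe_real//.
(* The real elements form a subring of [R[i]], to which [lambert_over] applies. *)
by apply/(fps_overP (@Num.Def.real_num_pred R[i]))/lambert_over; rewrite addn1.
Qed.

Lemma lam_over (T : subringClosed R[i]) l k : (lam l k)%:C%C \in T.
Proof.
by rewrite -lamE; apply/fps_overP/lambert_over; rewrite addn1.
Qed.

Lemma lam0 l : lam l 0 = 0.
Proof. by rewrite /lam fcoef_lambert_lt// addn1. Qed.

Lemma alphaE l : alpha R l = (-1) ^+ l * ubin R l.
Proof.
by rewrite /alpha ubinE exprNn invfM invr_sign -mulrA; congr (_ * _); rewrite mulrC.
Qed.

(** Since [u_m = (2m)! / (2^m m!)^2], the prefactor of [calP] yields [sqrt u_m]; the sign [(-1)^k]
    there cancels that of the product of [k] factors. *)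
Lemma etaE n l m : eta R n l m 0 =
  (Num.sqrt (ubin R m) * (Qpoly R m).[ynode R l])%:C%C.
Proof.
rewrite mxE /calP.
have fact_neq0 k : (k`!)%:R != 0 :> R by exact: fact_neq0.
have p2 k : 2 ^+ k != 0 :> R by rewrite expf_neq0// pnatr_eq0.
have ufact k : ubin R k = (2 * k)`!%:R / (2 ^+ k * k`!%:R) ^+ 2.
  rewrite ubinE; have := @bin_fact (2 * k) k ltac:(lia).
  rewrite (_ : 2 * k - k = k)%N; last by lia.
  move/(congr1 (fun i => i%:R : R)); rewrite !natrM => <-.
  have -> : (4 : R) ^+ k = (2 ^+ k) ^+ 2 by rewrite -exprM mulnC exprM -[2 ^+ 2]natrX.
  by field; rewrite !fact_neq0 p2.
have -> : Num.sqrt (ubin R m) = Num.sqrt ((2 * m)`!%:R) / (2 ^+ m * m`!%:R).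
  rewrite ufact sqrtrM ?ler0n// sqrtrV ?exprn_ge0 ?mulr_ge0 ?exprn_ge0 ?ler0n//.
  by rewrite sqrtr_sqr ger0_norm// mulr_ge0 ?exprn_ge0 ?ler0n.
move: (Num.sqrt _) => A.
transitivity (A%:C%C * ((2 ^+ m * m`!%:R)^-1 * (Qpoly R m).[ynode R l])%:C%C); last first.
  by rewrite -[LHS]rmorphM mulrA.
apply: (congr1 (fun z => A%:C%C * z)).
rewrite Qpoly_ynode mulr_sumr rmorph_sum; apply: eq_bigr => k _.
have lekm : (k <= m)%N by rewrite -ltnS.
have -> : \prod_(j < k) (j%:R - 'i%C * (- 'i%C * (1 / 2 + 2 * l%:R)) / 2 + 1 / 4)
    = (-1) ^+ k * ((k`! * 'C(l, k))%:R : R)%:C%C.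
  rewrite -ffpoly_ynode /ffpoly horner_prod rmorph_prod -[k in (-1) ^+ k]card_ord.
  rewrite -prodr_const -big_split /=; apply: eq_bigr => j _.
  rewrite !(hornerD, hornerN, hornerM, hornerZ, hornerX, hornerC) /ynode.
  rewrite !(rmorph_nat, rmorphD, rmorphN, rmorphM, fmorphV) /=.
  have -> : 'i%C * (- 'i%C * (1 / 2 + 2 * l%:R)) = 1 / 2 + 2 * l%:R :> R[i].
    by rewrite mulrA mulrN -expr2 sqr_i opprK !mul1r.
  by field.
rewrite ufact expfzDr ?pnatr_eq0// -exprnN -!exprnP [(3 * k)%N]mulnC exprM.
have mE : (m`!)%:R = 'C(m, k)%:R * (k`!%:R * (m - k)`!%:R) :> R.
  by rewrite -!natrM bin_fact.
rewrite {}mE natrM.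
rewrite !(rmorph_nat, rmorphM, fmorphV, rmorphXn) /=.
have sg : (-1) ^+ k * (-1) ^+ k = 1 :> R[i] by rewrite -exprMn mulN1r opprK expr1n.
have f0 i : (i`!)%:R != 0 :> R[i] by rewrite pnatr_eq0 -lt0n fact_gt0.
have c0 : ('C(m, k))%:R != 0 :> R[i] by rewrite pnatr_eq0 -lt0n bin_gt0.
have q0 i : 2 ^+ i != 0 :> R[i] by rewrite expf_neq0// pnatr_eq0.
move: sg; set sgn := (-1) ^+ k => sg.
transitivity (sgn * sgn * ((2 ^+ k) ^+ 3 / 2 ^+ m *
  (k`!%:R * 'C(l, k)%:R) / ((2 * k)`!%:R * (m - k)`!%:R)) : R[i]).
  by field; rewrite ?f0 ?q0.
by rewrite sg mul1r; field; rewrite ?f0 ?q0 ?c0.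
Qed.

(* The coefficient of [lambert (2 * l + 1)] in a matrix element of [opA], up to
   the factor [(-1) ^+ s * 2 `^ (3 / 2)]. *)
Definition opA_coef i j l : R := (-1) ^+ l * (ubin R l *
  (Num.sqrt (ubin R i) * (Qpoly R i).[ynode R l]) *
  (Num.sqrt (ubin R j) * (Qpoly R j).[ynode R l])).

Lemma opA_formula_coef n (s : bool) (i j : 'I_n.+1) k :
  odd i = s -> odd j = s ->
  fcoef (opA_formula R n s i j) k = (-1) ^+ s * (2 * sqrt2)%:C%C *
    \sum_(l < k.+1) (opA_coef i j l)%:C%C * (lam l k)%:C%C.
Proof.
move=> oi oj; rewrite mxE.
have etapm (a : 'I_n.+1) l : odd a = s -> eta_pm R n s l a 0 = eta R n l a 0.
  move=> oa; rewrite mxE -(signr_odd _ a) oa -exprMn mulN1r opprK expr1n.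
  by rewrite (_ : (1 + 1) / 2 = 1) ?mul1r//; field.
have -> : (2 : R) `^ (3 / 2) = 2 * sqrt2.
  have -> : 3 / 2 = 1 + 2^-1 :> R by field.
  by rewrite powRD ?pnatr_eq0 ?implybT// powRr1 ?powR12_sqrt.
have -> : (-1) ^+ s * fpsC (2 * sqrt2)%:C%C =
          fpsC ((-1) ^+ s * (2 * sqrt2)%:C%C) :> fps R[i].
  by rewrite [RHS]rmorphM /= rmorph_sign.
rewrite fcoefCM; congr (_ * _).
under [in LHS]eq_fun => l do rewrite mulrAC -rmorphM mxE !etapm// !etaE.
rewrite fcoef_lfsum_lambert; apply: eq_bigr => l _.
rewrite fcoefCM lamE; congr (_ * _).
rewrite alphaE conj_Creal; last by apply/complex_realP; eexists.
by rewrite -!rmorphM /= /opA_coef !mulrA.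
Qed.

End Entries.

(** * Integrality of the matrix elements and of the traces *)

Section Traces.
Variable R : realType.
Local Notation S := (subring_pred [set ((Num.sqrt 2)^-1)%:C%C : R[i]]%classic).
Local Notation Z := (subring_pred (@cyclotomic_integers R `|` [set 2^-1])%classic).
Local Notation sqrt2 := (Num.sqrt 2 : R).

Lemma Qpoly_ynode_ge0 m l : 0 <= (Qpoly R m).[ynode R l].
Proof.
rewrite Qpoly_ynode sumr_ge0// => k _.
rewrite !mulr_ge0 ?invr_ge0 ?exprn_ge0 ?ler0n//.
by rewrite ubinE mulr_ge0 ?invr_ge0 ?exprn_ge0 ?ler0n.
Qed.

Lemma ubin_gt0 m : 0 < ubin R m.
Proof.
by rewrite lt0r ubin_neq0 ubinE mulr_ge0 ?invr_ge0 ?exprn_ge0 ?ler0n.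
Qed.

Lemma sqrt_ubin_neq0 m : Num.sqrt (ubin R m) != 0.
Proof. by rewrite gt_eqF// sqrtr_gt0 ubin_gt0. Qed.

Lemma sqr_sqrt_ubin m : Num.sqrt (ubin R m) * Num.sqrt (ubin R m) = ubin R m.
Proof. by rewrite -expr2 sqr_sqrtr// ltW// ubin_gt0. Qed.

(** Apart from its sign the coefficient is nonnegative, and its square is a product of four dyadic
    numbers: one factor [ubin l] goes with each of the two polynomials. *)
Lemma opA_coef_Zcyc i j l : (opA_coef R i j l)%:C%C \in Z.
Proof.
rewrite /opA_coef rmorphM rmorphXn rmorphN1 rpredM ?rpredX ?rpredN1//.
set x := _ * _ * _.
pose z := (ubin R i * (Qpoly R i).[ynode R l]) * (ubin R l * (Qpoly R i).[ynode R l])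
        * ((ubin R j * (Qpoly R j).[ynode R l]) * (ubin R l * (Qpoly R j).[ynode R l])).
have zD : z \in @dyadic R.
  by apply: rpredM; apply: rpredM; do ?[exact: ubin_Qpoly_dyadic |
    exact: ubin_node_Qpoly_dyadic].
have x0 : 0 <= x.
  have sQ a : 0 <= Num.sqrt (ubin R a) * (Qpoly R a).[ynode R l].
    by rewrite mulr_ge0 ?sqrtr_ge0 ?Qpoly_ynode_ge0.
  exact: mulr_ge0 (mulr_ge0 (ltW (ubin_gt0 l)) (sQ i)) (sQ j).
have xx : x ^+ 2 = z.
  rewrite /z -(sqr_sqrt_ubin i) -(sqr_sqrt_ubin j) /x; ring.
have -> : x = Num.sqrt z by rewrite -xx sqrtr_sqr ger0_norm.
by apply: sqrt_dyadic_Zcyc => //; rewrite -xx exprn_ge0.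
Qed.

Lemma opA_enum n s (a b : 'I_(H_dim n s)) :
  opA R n s a b = opA_formula R n s (enum_val a) (enum_val b).
Proof.
rewrite !mxE (bigD1 (enum_val b))//= big1 ?addr0; last first.
  by move=> j jb; rewrite [X in _ * X]mxE (negPf jb) mulr0.
rewrite [X in _ * X]mxE eqxx mulr1 mxE (bigD1 (enum_val a))//= big1 ?addr0.
  by rewrite !mxE eqxx mul1r.
by move=> i ia; rewrite 2![X in X * _]mxE (negPf ia) mul0r.
Qed.

Lemma odd_enum_val n s (a : 'I_(H_dim n s)) : odd (enum_val a) = s.
Proof. by have := enum_valP a; rewrite inE => /eqP. Qed.

Lemma opA_fcoef n s (a b : 'I_(H_dim n s)) k :
  fcoef (opA R n s a b) k = (-1) ^+ s * (2 * sqrt2)%:C%C *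
    \sum_(l < k.+1)
      (opA_coef R (enum_val a) (enum_val b) l)%:C%C * (lam R l k)%:C%C.
Proof. by rewrite opA_enum opA_formula_coef ?odd_enum_val. Qed.

Lemma gamma_Zcyc n i j k : fcoef (gamma_mx R n i j) k \in Z.
Proof.
move: k; apply/fps_overP.
have H01 s i' a : H_incl R n s i' a \in fps_over Z by rewrite mxE rpred_nat.
rewrite summxE rpred_sum// => s _; rewrite mxE rpred_sum// => a _.
rewrite rpredM//; last by rewrite mxE.
rewrite mxE rpred_sum// => b _; rewrite rpredM//.
apply/fps_overP => k; rewrite opA_fcoef rpredM//.
  rewrite rpredM ?rpredX ?rpredN1// rmorphM rmorph_nat rpredM ?rpred_nat//.
  exact: sqrt_nat_Zcyc.
by rewrite rpred_sum// => l _; rewrite rpredM ?lam_over// opA_coef_Zcyc.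
Qed.

Lemma tr_extpow_opA n s m k : fcoef (\tr (extpow m (opA R n s))) k \in S.
Proof.
pose w (a : 'I_(H_dim n s)) : R[i] := (Num.sqrt (ubin R (enum_val a)))%:C%C.
have w0 a : w a != 0 by rewrite fmorph_eq0 sqrt_ubin_neq0.
have wU a : fpsC (w a) \is a GRing.unit by rewrite rmorph_unit// unitfE.
pose B : 'M[fps R[i]]_(H_dim n s) := \matrix_(a, b) (fpsC (w a / w b) * opA R n s a b).
rewrite -(@tr_extpow_conj _ _ m (opA R n s) B (fun a => fpsC (w a)))//; last first.
  by move=> a b; rewrite mxE mulrAC -rmorphM /= divfK.
move: k; apply/fps_overP/tr_extpow_over => a b; apply/fps_overP => k.
rewrite mxE fcoefCM opA_fcoef mulrCA rpredM//.
  rewrite rpredM ?rpredX ?rpredN1// rmorphM rmorph_nat rpredM ?rpred_nat//.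
  exact: sqrt2_over.
rewrite mulr_sumr rpred_sum// => l _; rewrite mulrA rpredM ?lam_over//.
rewrite -fmorph_div -rmorphM dyadic_over//.
set i := enum_val a; set j := enum_val b.
(* The quotient turns [sqrt u_i * sqrt u_j] into [u_i], which goes with [Q_i(y_l)], while [u_l] goes
   with [Q_j(y_l)]. *)
have -> : Num.sqrt (ubin R i) / Num.sqrt (ubin R j) * opA_coef R i j l =
  (-1) ^+ l * ((ubin R i * (Qpoly R i).[ynode R l]) *
               (ubin R l * (Qpoly R j).[ynode R l])).
  rewrite /opA_coef; move: (sqr_sqrt_ubin i) (sqrt_ubin_neq0 j).
  move: (Num.sqrt (ubin R i)) (Num.sqrt (ubin R j)) => c e <- e0.
  by field.
apply: rpredM; first by rewrite rpredX ?rpredN1.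
by apply: rpredM; [exact: ubin_Qpoly_dyadic | exact: ubin_node_Qpoly_dyadic].
Qed.

(** * The Hankel matrix in the basis of the polynomials [Q_m] *)

Lemma size_ffpoly k : (size (ffpoly R k) <= k.+1)%N.
Proof.
elim: k => [|k IHk]; first by rewrite /ffpoly big_ord0 size_poly1.
pose f : {poly R} := 2^-1 *: 'X - (4^-1 + k%:R)%:P.
have sf : (size f <= 2)%N.
  rewrite (leq_trans (size_polyD _ _))// geq_max size_polyN.
  rewrite (leq_trans (size_scale_leq _ _)) ?size_polyX//=.
  by rewrite (leq_trans (size_polyC_leq1 _)).
rewrite ffpolyS (leq_trans (size_polyMleq _ _))//.
by rewrite -/f; move: (size (ffpoly R k)) (size f) IHk sf => a b; lia.
Qed.

Lemma size_Qpoly m : (size (Qpoly R m) <= m.+1)%N.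
Proof.
apply: (leq_trans (size_sum _ _ _)); apply/bigmax_leqP => k _.
apply: (leq_trans (size_scale_leq _ _)); apply: leq_trans (size_ffpoly k) _.
exact: ltn_ord.
Qed.

Lemma base0 : @base R 0 * sqrt2 = 1.
Proof.
rewrite /base oppr0 expR0 div1r powRN powR12_sqrt ?addr_ge0//.
by rewrite (_ : 1 + 1 = 2)// mulVf// sqrt2_neq0.
Qed.

Lemma sigm0 : @sigm R 0 = 2^-1.
Proof. by rewrite /sigm oppr0 expR0 div1r. Qed.

(* [fcoef (cq R j) k] divided by ['i ^+ j] *)
Definition hmom k j : R := (k == 0%N)%:R * (@base R 0 * muT (1 : {poly R}) j) +
  \sum_(l < k.+1) lam R l k * alpha R l *
    (ynode R l ^+ j + (- ynode R l) ^+ j).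

(** One formula for both parities: for even [j] the two node powers give the factor [2] of [cq], for
    odd [j] they cancel and [muT1_odd] removes the constant part. *)
Lemma cq_coef j k : fcoef (cq R j) k = 'i%C ^+ j * (hmom k j)%:C%C.
Proof.
rewrite /cq /hmom; case: ifPn => [oj|ej].
  rewrite muT1_odd// !mulr0 add0r big1 ?mulr0; first by case: k.
  by move=> l _; rewrite exprNn -signr_odd oj mulN1r subrr mulr0.
have jE : j = (2 * j./2)%N by rewrite mul2n; lia.
have iE : 'i%C ^+ j = (-1) ^+ j./2 :> R[i] by rewrite {1}jE exprM sqr_i.
rewrite iE fcoefD rmorphD mulrDr; congr (_ + _).
  have -> : c0 R j = (-1) ^+ j./2 * (@base R 0 * muT 1 j).
    by rewrite /c0 (negPf ej) [X in _ * X]derive1n_base sigm0.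
  case: k => [|k] /=; last by rewrite mul0r rmorph0 mulr0.
  by rewrite mul1r rmorphM rmorph_sign.
have -> : (2 : fps R[i]) * (-1) ^+ j./2 = fpsC (2 * (-1) ^+ j./2).
  by rewrite rmorphM rmorph_sign rmorph_nat.
rewrite fcoefCM fcoef_lfsum_lambert [2 * _]mulrC -mulrA; congr (_ * _).
rewrite mulr_sumr rmorph_sum; apply: eq_bigr => l _.
rewrite fcoefCM lamE -(rmorph_nat (real_complex R) 2).
rewrite -!(rmorphM (real_complex R)) /=.
congr (_%:C%C); rewrite exprNn -signr_odd (negPf ej) mul1r /ynode.
by ring.
Qed.

(** The node powers are moments of point masses at [y_l] and [- y_l], so their contribution is
    evaluation there. *)
Lemma mom_hmom k m n : mom (hmom k) (Qpoly R m * (Qpoly R n \Po - 'X)) =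
  (k == 0%N)%:R * (@base R 0 * gram R m n) + \sum_(l < k.+1) lam R l k * alpha R l *
    ((Qpoly R m).[ynode R l] * (Qpoly R n).[- ynode R l] +
     (Qpoly R m).[- ynode R l] * (Qpoly R n).[ynode R l]).
Proof.
rewrite /hmom momD !momZ; congr (_ + _).
rewrite /mom; under eq_bigr do rewrite mulr_sumr; rewrite exchange_big /=.
apply: eq_bigr => l _; rewrite -/(mom (fun j => lam R l k * alpha R l *
  (ynode R l ^+ j + (- ynode R l) ^+ j)) _) momZ momD !mom_horner.
by rewrite !hornerM !horner_comp !hornerN !hornerX opprK.
Qed.

Section Determinant.
Variable n : nat.

(** The powers of [- 'i] and ['i] in the two factors meet the ['i ^+ (a + b)] of [cq_coef] and leave
    the sign [(-1) ^+ b] of [mom_bilinear]; [sqrt2 * ubin m] makes the diagonal equal to [1] at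
    [q = 0]. *)
Definition leftmx : 'M[R[i]]_n.+1 :=
  \matrix_(m, a) ((sqrt2 * ubin R m * (Qpoly R m)`_a)%:C%C * (- 'i%C) ^+ a).
Definition rightmx : 'M[R[i]]_n.+1 :=
  \matrix_(b, m) (((Qpoly R m)`_b)%:C%C * 'i%C ^+ b).
Definition redmx : 'M[fps R[i]]_n.+1 :=
  map_mx (@fpsC R[i]) leftmx *m Hankel R n *m map_mx (@fpsC R[i]) rightmx.

Lemma redmx_coef (m m' : 'I_n.+1) k : fcoef (redmx m m') k =
  (sqrt2 * ubin R m * mom (hmom k) (Qpoly R m * (Qpoly R m' \Po - 'X)))%:C%C.
Proof.
rewrite -(@mom_bilinear _ _ _ _ n); last 2 first.
- by rewrite (leq_trans (size_Qpoly _)).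
- by rewrite (leq_trans (size_Qpoly _)).
rewrite exchange_big mulr_sumr rmorph_sum mxE fcoef_sum; apply: eq_bigr => b _.
rewrite mxE mulr_suml fcoef_sum mulr_sumr rmorph_sum; apply: eq_bigr => a _.
rewrite !mxE mulrAC -rmorphM fcoefCM cq_coef exprD.
have i1 c : (- 'i%C) ^+ c * 'i%C ^+ c = 1 :> R[i].
  by rewrite -exprMn mulNr -expr2 sqr_i opprK expr1n.
have i2 c : 'i%C ^+ c * 'i%C ^+ c = (-1) ^+ c :> R[i].
  by rewrite -exprMn -expr2 sqr_i.
transitivity ((sqrt2 * ubin R m * (Qpoly R m)`_a)%:C%C * ((Qpoly R m')`_b)%:C%C *
   (hmom k (a + b))%:C%C * ((- 'i%C) ^+ a * 'i%C ^+ a) * ('i%C ^+ b * 'i%C ^+ b)).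
  by ring.
rewrite i1 i2 mulr1 -[(-1) ^+ b](rmorph_sign (real_complex R)) -!rmorphM /=.
by congr (_%:C%C); ring.
Qed.

Lemma redmx_coef0 m m' : fcoef (redmx m m') 0 = (m == m')%:R.
Proof.
rewrite redmx_coef mom_hmom gram_diag mul1r big1 ?addr0; last first.
  by move=> l _; rewrite lam0 !mul0r.
rewrite (inj_eq val_inj); case: eqP => [_|_]; last by rewrite !mulr0.
have -> : sqrt2 * ubin R m * (@base R 0 * (m`!%:R / hpoch R m)) = @base R 0 * sqrt2.
  by rewrite /ubin; field; rewrite hpoch_neq0 fact_neq0.
by rewrite base0.
Qed.

Lemma redmx_over m m' : redmx m m' \in fps_over S.
Proof.
(* The Gram part occurs only in the constant term; in higher ones each [u_m] is paired with a value
   of [Q_m] and each [u_l] with one of [Q_m']. *)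
apply/fps_overP => -[|k]; first by rewrite redmx_coef0 rpred_nat.
rewrite redmx_coef mom_hmom mul0r add0r rmorphM rmorph_sum /=.
rewrite mulr_sumr rpred_sum// => l _; set Q := _ + _.
rewrite -(rmorphM (real_complex R)) /=.
have -> : sqrt2 * ubin R m * (lam R l k.+1 * alpha R l * Q) =
  lam R l k.+1 * (sqrt2 * ((-1) ^+ l * (ubin R l * (ubin R m * Q)))).
  by rewrite alphaE; ring.
rewrite 2!(rmorphM (real_complex R)) /= rpredM//; first exact: lam_over.
rewrite rpredM//; first exact: sqrt2_over.
apply: dyadic_over; rewrite rpredM ?rpredX ?rpredN1// /Q.
have -> : ubin R l * (ubin R m * ((Qpoly R m).[ynode R l] * (Qpoly R m').[- ynode R l] +
   (Qpoly R m).[- ynode R l] * (Qpoly R m').[ynode R l])) =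
  (ubin R m * (Qpoly R m).[ynode R l]) * (ubin R l * (Qpoly R m').[- ynode R l]) +
  (ubin R m * (Qpoly R m).[- ynode R l]) * (ubin R l * (Qpoly R m').[ynode R l]).
  by ring.
apply: rpredD; apply: rpredM.
- exact: ubin_Qpoly_dyadic.
- exact: ubin_node_QpolyN_dyadic.
- exact: ubin_QpolyN_dyadic.
- exact: ubin_node_Qpoly_dyadic.
Qed.

(** [\det redmx] is a constant multiple of [Dq] with constant term [1], hence the normalized
    determinant; [d1] also shows that the constant term of [Dq] is nonzero. *)
Lemma Dq_over k : fcoef (Dq R n / fpsC (fcoef (Dq R n) 0)) k \in S.
Proof.
have detE : \det redmx = Dq R n * fpsC (\det leftmx * \det rightmx).
  by rewrite !det_mulmx !det_map_mx rmorphM /= mulrA [_ * \det (Hankel R n)]mulrC.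
have det0 : fcoef (\det redmx) 0 = 1.
  rewrite -/(fps_coef0 _) -det_map_mx (_ : map_mx _ _ = 1%:M) ?det1//.
  by apply/matrixP => m m'; rewrite mxE [RHS]mxE; exact: redmx_coef0.
have d1 : fcoef (Dq R n) 0 * (\det leftmx * \det rightmx) = 1.
  by rewrite -det0 detE -[RHS]/(fps_coef0 _) rmorphM.
suff -> : Dq R n / fpsC (fcoef (Dq R n) 0) = \det redmx.
  by move: k; apply/fps_overP/rpred_det; exact: redmx_over.
rewrite detE -fmorphV; congr (_ * fpsC _).
by apply: (mulfI (_ : fcoef (Dq R n) 0 != 0)); rewrite ?divff ?d1//;
  apply: contra_eq_neq d1 => ->; rewrite mul0r eq_sym oner_eq0.
Qed.

End Determinant.

End Traces.

Theorem theorem5p9 (R : realType) (n : nat) :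
  [/\ (forall (i j : 'I_n.+1) (k : nat),
         Zcyc_half (fcoef (gamma_mx R n i j) k)),
      (forall (s : bool) (m : nat), (1 <= m)%N -> forall k : nat,
         Z_invsqrt2 (fcoef (\tr (extpow m (opA R n s))) k))
    & (forall k : nat,
         Z_invsqrt2 (fcoef (Dq R n / fpsC (fcoef (Dq R n) 0)) k))].
Proof.
split=> [i j k|s m _ k|k]; apply/subring_predP.
- exact: gamma_Zcyc.
- exact: tr_extpow_opA.
- exact: Dq_over.
Qed.
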